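(* Let $\pi:K[U]\langle x_1,y_1,w_{33}\rangle\to T_{32}$ be the natural homomorphism and let $[U]\langle x_1,y_1,w_{33}\rangle$ be ordered as described in the context. Then the set $\{f_1,\dots,f_{11}\}$ is a Gröbner basis of $\operatorname{Ker}(\pi)$, where $$f_1=w_{33}x_1-x_1w_{33},\qquad f_2=w_{33}y_1-y_1w_{33},$$ $$f_3=w_{33}^2-\Big(\tfrac1{27}\omega_1-\tfrac29\omega_2+\tfrac4{15}\omega_3'+\tfrac1{90}\omega_3''+\tfrac13\omega_4-\tfrac23\omega_5-\tfrac13\omega_6-\tfrac4{27}\omega_7\Big),$$ $$f_4=18x_1w_{33}+F,\qquad f_5=-18y_1w_{33}+F',$$ $$f_6=x_1^3-\tfrac12u_{20}x_1-\tfrac13u_{30},$$ $$f_7=x_1^2y_1+x_1y_1x_1+y_1x_1^2-u_{11}x_1-\tfrac12u_{20}y_1-u_{21},$$ $$f_8=x_1y_1^2+y_1x_1y_1+y_1^2x_1-\tfrac12u_{02}x_1-u_{11}y_1-u_{12},$$ $$f_9=y_1^3-\tfrac12u_{02}y_1-\tfrac13u_{03},$$ $$f_{10}=6(x_1y_1)^2-6y_1^2x_1^2+3u_{02}x_1^2-6u_{11}x_1y_1+3u_{20}y_1^2+2(-u_{20}u_{02}+u_{11}^2+u_{22}),$$ $$\begin{aligned}f_{11}={}&36y_1^2x_1y_1x_1^2-6u_{02}x_1y_1x_1^2+12u_{11}\big((y_1x_1)^2-y_1^2x_1^2\big)-6u_{20}y_1^2x_1y_1\\ &+12u_{12}(x_1y_1x_1-y_1x_1^2)+12u_{21}(y_1x_1y_1-y_1^2x_1)\\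 &+(-u_{20}u_{02}+4u_{11}^2+4u_{22})x_1y_1+2(-u_{20}u_{02}-2u_{11}^2+4u_{22})y_1x_1\\ &+2(u_{20}u_{03}-6u_{11}u_{12}+3u_{02}u_{21})x_1+2(u_{02}u_{30}-6u_{11}u_{21}+3u_{20}u_{12})y_1\\ &+2(u_{20}u_{11}u_{02}-u_{11}^3+u_{30}u_{03}-3u_{21}u_{12}-u_{22}u_{11}-3w_{33}),\end{aligned}$$ and the elements $\omega_1,\omega_2,\omega_3',\omega_3'',\omega_4,\omega_5,\omega_6,\omega_7\in K[U]$ and $F,F'\in K[U]\langle x_1,y_1\rangle$ are those defined in the context.
   Context: **Trace algebra.** $K$ is a field of characteristic $0$; $X,Y$ are two generic $3\times3$ matrices (their $18$ entries are independent commuting variables over $K$). $C_{32}$ is the $K$-algebra generated by all traces of products of $X$ and $Y$, its elements being treated as scalar matrices, and $T_{32}$ is the $K$-algebra of matrices generated by $X,Y$ and $C_{32}$. Put $x=X-\frac13\operatorname{tr}(X)e$, $y=Y-\frac13\operatorname{tr}(Y)e$ ($e$ the identity matrix), $v=\operatorname{tr}(x^2y^2)-\operatorname{tr}(xyxy)$, $w=\operatorname{tr}(x^2y^2xy)-\operatorname{tr}(y^2x^2yx)$. **Free algebra and $\pi$.** $U=\{u_{10},u_{01},u_{20},u_{11},u_{02},u_{30},u_{21},u_{12},u_{03},u_{22}\}$ is a set of commuting variables, $[U]$ is the free commutative monoid on $U$, $K[U]$ the polynomial algebra, $\langle x_1,y_1,w_{33}\rangle$ is the free monoid on the noncommuting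 variables $x_1,y_1,w_{33}$, and $K[U]\langle x_1,y_1,w_{33}\rangle$ is the free associative unital algebra over $K[U]$; it has $K$-basis the direct product $[U]\langle x_1,y_1,w_{33}\rangle$, whose elements $af$ ($a\in[U]$, $f\in\langle x_1,y_1,w_{33}\rangle$) are called monomials. The $K$-algebra homomorphism $\pi$ is defined by $u_{10}\mapsto\operatorname{tr}(X)$, $u_{01}\mapsto\operatorname{tr}(Y)$, $u_{ij}\mapsto\operatorname{tr}(x^iy^j)$ for $i+j=2,3$, $u_{22}\mapsto v$, $x_1\mapsto x$, $y_1\mapsto y$, $w_{33}\mapsto w$. **Ordering.** Fix any total ordering on $[U]$ that satisfies the descending chain condition and is compatible with multiplication. Let $\deg x_1=\deg y_1=1$, $\deg w_{33}=6$. Words $f,g\in\langle x_1,y_1,w_{33}\rangle$ are compared first by degree ($f>g$ if $\deg f>\deg g$) and, in case of equal degree, lexicographically with $w_{33}>x_1>y_1$. For monomials, $af>bg$ if $f>g$, or if $f=g$ and $a>b$. **Gröbner basis.** For nonzero $z\in K[U]\langle x_1,y_1,w_{33}\rangle$, $z^0$ is the largest monomial occurring in $z$ with nonzero coefficient. A monomial $af$ divides $bg$ if $bg=ca\,h_1fh_2$ for some $c\in[U]$ and words $h_1,h_2$. A subset $B$ of a two-sided ideal $I$ is a Gröbner basis of $I$ if for every nonzero $z\in I$ there is $z_i\in B$ such that $z_i^0$ divides $z^0$. **The elements $\omega$.** Put $u=u_{20}u_{02}-u_{11}^2$ and $$\Delta=\begin{vmatrix}u_{20}&u_{11}&u_{02}\\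 u_{30}&u_{21}&u_{12}\\ u_{21}&u_{12}&u_{03}\end{vmatrix}.$$ Then $\omega_1=u^3$, $\omega_2=u^2u_{22}$, $\omega_4=u\,u_{22}^2$, $\omega_7=u_{22}^3$, $\omega_5=u_{22}\Delta$, $\omega_3'=u\Delta$, $$\omega_6=(u_{30}u_{03}-u_{12}u_{21})^2-4(u_{03}u_{21}-u_{12}^2)(u_{30}u_{12}-u_{21}^2),$$ $$\begin{aligned}\omega_3''={}&5(u_{02}^3u_{30}^2+u_{20}^3u_{03}^2)-30(u_{02}^2u_{11}u_{21}u_{30}+u_{20}^2u_{11}u_{03}u_{12})\\ &+3\{(4u_{02}u_{11}^2+u_{02}^2u_{20})(3u_{21}^2+2u_{12}u_{30})+(4u_{11}^2u_{20}+u_{20}^2u_{02})(3u_{12}^2+2u_{21}u_{03})\}\\ &-2(2u_{11}^3+3u_{20}u_{11}u_{02})(9u_{12}u_{21}+u_{30}u_{03}).\end{aligned}$$ **The elements $F,F'$.** With $[a,b]=ab-ba$, $a\circ b=ab+ba$, $$F=-4U_1-2U_2+10U_3+18U_4-6U_5+9U_6+15U_7-4U_8-4U_{10}+12U_{11}-36U_{12}+12U_{13},$$ where $U_1=u_{11}u_{02}u_{30}-2u_{11}^2u_{21}-u_{20}u_{02}u_{21}+3u_{20}u_{11}u_{12}-u_{20}^2u_{03}$; $U_2=(u_{20}u_{02}-u_{11}^2)(u_{20}y_1-u_{11}x_1)$; $U_3=u_{22}(u_{20}y_1-u_{11}x_1)$; $U_4=u_{30}(u_{03}x_1-2u_{12}y_1)-u_{21}(u_{12}x_1-2u_{21}y_1)$;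 $U_5=u_{20}(u_{03}x_1^2-u_{12}(x_1\circ y_1)+u_{21}y_1^2)-u_{11}(u_{12}x_1^2-u_{21}(x_1\circ y_1)+u_{30}y_1^2)$; $U_6=2(u_{11}u_{12}-u_{02}u_{21})x_1^2-(u_{20}u_{12}-u_{02}u_{30})(x_1\circ y_1)+2(u_{20}u_{21}-u_{11}u_{30})y_1^2$; $U_7=(u_{20}u_{12}-2u_{11}u_{21}+u_{02}u_{30})[x_1,y_1]$; $U_8=(u_{20}u_{02}-u_{11}^2)[x_1,y_1]x_1$; $U_{10}=(u_{20}u_{02}-u_{11}^2)[x_1^2,y_1]$; $U_{11}=u_{22}[x_1^2,y_1]$; $U_{12}=u_{30}[x_1,y_1]y_1^2-u_{21}[x_1,y_1](x_1\circ y_1)+u_{12}[x_1,y_1]x_1^2$; $U_{13}=u_{20}[x_1,y_1]^2y_1-u_{11}[x_1,y_1]^2x_1$. $F'$ is obtained from $F$ by interchanging the roles of the two matrices, i.e. by the simultaneous substitution $x_1\leftrightarrow y_1$, $u_{20}\leftrightarrow u_{02}$, $u_{30}\leftrightarrow u_{03}$, $u_{21}\leftrightarrow u_{12}$, with $u_{11}$ and $u_{22}$ fixed. *)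

(* Defs.v *)
From HB Require Import structures.
From mathcomp Require Import all_boot all_order all_algebra.
(* Order matters: mpoly must mask the homonymous notations and names of monalg. *)
From mathcomp Require Import monalg.
From mathcomp Require Import mpoly.

Set Implicit Arguments.
Unset Strict Implicit.
Unset Printing Implicit Defensive.

Import Order.TTheory GRing.Theory.
Local Open Scope ring_scope.

Variant letter := Lx | Ly | Lw.

(* Encodes the ordering w_33 > x_1 > y_1 of the letters. *)
Definition letter_rank (l : letter) : nat :=
  match l with Ly => 0 | Lx => 1 | Lw => 2 end.
Definition letter_of_rank (n : nat) : letter :=
  match n with 0 => Ly | 1 => Lx | _ => Lw end.
Lemma letter_rankK : cancel letter_rank letter_of_rank.
Proof. by case. Qed.
HB.instance Definition _ := Countable.copy letter (can_type letter_rankK).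

Notation word := {fmonom letter}.

Definition wcat (f g : word) : word := monalg.mul f g.

(* [U] is written additively, as the monoid of exponent vectors of K[U]; the
   variables are numbered in the order 10, 01, 20, 11, 02, 30, 21, 12, 03, 22. *)
Notation Umon := 'X_{1..10}.
Notation KU K := {mpoly K[10]}.
Notation freeKU K := {malg KU K[word]}.

Section Generators.
Variable K : fieldType.

Definition uvar (i : nat) : KU K := 'X_(inord i).
Definition u10 := uvar 0.
Definition u01 := uvar 1.
Definition u20 := uvar 2.
Definition u11 := uvar 3.
Definition u02 := uvar 4.
Definition u30 := uvar 5.
Definition u21 := uvar 6.
Definition u12 := uvar 7.
Definition u03 := uvar 8.
Definition u22 := uvar 9.

Definition lvar (l : letter) : freeKU K := monalg.mkmalgU (monalg.fmu l) 1.
Definition x1 := lvar Lx.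
Definition y1 := lvar Ly.
Definition w33 := lvar Lw.

End Generators.

Arguments u10 {K}.
Arguments u01 {K}.
Arguments u20 {K}.
Arguments u11 {K}.
Arguments u02 {K}.
Arguments u30 {K}.
Arguments u21 {K}.
Arguments u12 {K}.
Arguments u03 {K}.
Arguments u22 {K}.
Arguments x1 {K}.
Arguments y1 {K}.
Arguments w33 {K}.

Section TraceAlgebra.
Variable K : fieldType.

Notation KXY := {mpoly K[3 * 3 + 3 * 3]}.

Definition genX : 'M[KXY]_3 :=
  \matrix_(i, j) 'X_(lshift (3 * 3) (mxvec_index i j)).
Definition genY : 'M[KXY]_3 :=
  \matrix_(i, j) 'X_(rshift (3 * 3) (mxvec_index i j)).

Definition genXY (b : bool) : 'M[KXY]_3 := if b then genX else genY.

Inductive in_C32 : KXY -> Prop :=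
| C32_const c : in_C32 c%:MP
| C32_tr s : in_C32 (\tr (\prod_(b <- s) genXY b))
| C32_add p q : in_C32 p -> in_C32 q -> in_C32 (p + q)
| C32_mul p q : in_C32 p -> in_C32 q -> in_C32 (p * q).

Inductive in_T32 : 'M[KXY]_3 -> Prop :=
| T32_X : in_T32 genX
| T32_Y : in_T32 genY
| T32_C p : in_C32 p -> in_T32 p%:M
| T32_add A B : in_T32 A -> in_T32 B -> in_T32 (A + B)
| T32_mul A B : in_T32 A -> in_T32 B -> in_T32 (A * B).

Definition trless (A : 'M[KXY]_3) : 'M[KXY]_3 := A - (3%:R^-1 *: \tr A)%:M.
Definition xm := trless genX.
Definition ym := trless genY.
Definition vtr : KXY := \tr (xm ^+ 2 * ym ^+ 2) - \tr (xm * ym * xm * ym).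
Definition wtr : KXY :=
  \tr (xm ^+ 2 * ym ^+ 2 * xm * ym) - \tr (ym ^+ 2 * xm ^+ 2 * ym * xm).

Definition Uimage : 10.-tuple KXY :=
  [tuple \tr genX; \tr genY;
         \tr (xm ^+ 2); \tr (xm * ym); \tr (ym ^+ 2);
         \tr (xm ^+ 3); \tr (xm ^+ 2 * ym); \tr (xm * ym ^+ 2); \tr (ym ^+ 3);
         vtr].

Definition piU (p : KU K) : 'M[KXY]_3 := (p \mPo Uimage)%:M.

Definition letter_image (l : letter) : 'M[KXY]_3 :=
  match l with Lx => xm | Ly => ym | Lw => wtr%:M end.

Definition word_image (f : word) : 'M[KXY]_3 := \prod_(l <- f) letter_image l.

Definition pi (z : freeKU K) : 'M[KXY]_3 := monalg.mmap piU word_image z.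

Definition Ker_pi (z : freeKU K) : Prop := pi z = 0.

End TraceAlgebra.

Section PiTheory.
Variable K : fieldType.
Local Notation KXY := {mpoly K[3 * 3 + 3 * 3]}.

Lemma piU_is_additive : additive (@piU K).
Proof. by move=> p q; rewrite /piU !raddfB. Qed.
HB.instance Definition _ :=
  GRing.isAdditive.Build (KU K) 'M[KXY]_3 (@piU K) piU_is_additive.
Lemma piU_is_multiplicative : multiplicative (@piU K).
Proof.
split=> [p q|]; last by rewrite /piU rmorph1.
by rewrite /piU rmorphM scalar_mxM.
Qed.
HB.instance Definition _ :=
  GRing.isMultiplicative.Build (KU K) 'M[KXY]_3 (@piU K) piU_is_multiplicative.

Lemma word_image_is_mmorphism : monalg.mmorphism (@word_image K).
Proof.
split=> [f g|]; rewrite /word_image.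
  by rewrite monalg.fmM big_cat.
by rewrite monalg.fm1 big_nil.
Qed.
HB.instance Definition _ :=
  monalg.isMultiplicative.Build word 'M[KXY]_3 (@word_image K)
    word_image_is_mmorphism.

Lemma pi_is_additive : additive (@pi K).
Proof. exact: monalg.mmap_is_additive. Qed.
HB.instance Definition _ :=
  GRing.isAdditive.Build (freeKU K) 'M[KXY]_3 (@pi K) pi_is_additive.
Lemma pi_is_multiplicative : multiplicative (@pi K).
Proof.
apply: monalg.commr_mmap_is_multiplicative => z f g.
exact/comm_mx_sym/comm_mx_scalar.
Qed.
HB.instance Definition _ :=
  GRing.isMultiplicative.Build (freeKU K) 'M[KXY]_3 (@pi K)
    pi_is_multiplicative.

Lemma piZ (p : KU K) z : pi (p *: z) = (p \mPo Uimage K) *: pi z.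
Proof. by rewrite /pi monalg.mmapZ /piU /= -mulmxE mul_scalar_mx. Qed.

Lemma pi_lvar l : pi (lvar K l) = letter_image K l.
Proof.
rewrite /pi /lvar monalg.mmapU /= rmorph1 mul1r.
by rewrite /word_image monalg.fmU big_seq1.
Qed.

Lemma in_C32Z c (p : KXY) : in_C32 p -> in_C32 (c *: p).
Proof. by move=> Cp; rewrite -mul_mpolyC; apply: C32_mul => //; apply: C32_const. Qed.

Lemma in_C32_1 : in_C32 (1 : KXY).
Proof. by rewrite -[1]/(1%:MP : KXY); apply: C32_const. Qed.

Lemma in_C32N (p : KXY) : in_C32 p -> in_C32 (- p).
Proof. by move=> Cp; rewrite -scaleN1r; apply: in_C32Z. Qed.

Lemma in_C32B (p q : KXY) : in_C32 p -> in_C32 q -> in_C32 (p - q).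
Proof. by move=> Cp Cq; apply: C32_add => //; apply: in_C32N. Qed.

Lemma in_T32_tr (A : 'M[KXY]_3) : in_T32 A -> in_C32 (\tr A).
Proof.
pose W s : 'M[KXY]_3 := \prod_(b <- s) genXY K b.
pose P B := forall s, in_C32 (\tr (B * W s)).
have Wcons b s : W (b :: s) = genXY K b * W s by rewrite /W big_cons.
suff Q : in_T32 A -> forall B, P B -> P (B * A).
  move=> /Q/(_ 1) Q1; have := Q1 _ [::]; rewrite /W big_nil mul1r mulr1.
  by apply=> s; rewrite mul1r; apply: C32_tr.
elim=> {A} [||p Cp|A B _ IHA _ IHB|A B _ IHA _ IHB] D PD s.
- by rewrite -mulrA -(Wcons true).
- by rewrite -mulrA -(Wcons false).
- rewrite -[D * _]/(D *m _) mul_mx_scalar -[_ * W s]/(_ *m W s) -scalemxAl.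
  by rewrite mxtraceZ; apply: C32_mul => //; apply: PD.
- by rewrite mulrDr mulrDl mxtraceD; apply: C32_add; [apply: IHA|apply: IHB].
- by rewrite mulrA; apply: IHB => //; apply: IHA.
Qed.

Lemma in_T32_trless (A : 'M[KXY]_3) : in_T32 A -> in_T32 (trless A).
Proof.
move=> TA; rewrite /trless -raddfN; apply: T32_add => //; apply: T32_C.
by apply: in_C32N; apply: in_C32Z; apply: in_T32_tr.
Qed.

Lemma in_T32_xm : in_T32 (xm K). Proof. exact/in_T32_trless/T32_X. Qed.
Lemma in_T32_ym : in_T32 (ym K). Proof. exact/in_T32_trless/T32_Y. Qed.

Lemma in_T32_1 : in_T32 (1 : 'M[KXY]_3).
Proof. by rewrite -[1]/(1%:M : 'M[KXY]_3); apply/T32_C/in_C32_1. Qed.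

Lemma in_T32_exp (A : 'M[KXY]_3) n : in_T32 A -> in_T32 (A ^+ n).
Proof.
by move=> TA; elim: n => [|n IH]; [exact: in_T32_1 | rewrite exprS; apply: T32_mul].
Qed.

Lemma in_C32_Uimage i : in_C32 (tnth (Uimage K) i).
Proof.
have Tx := in_T32_xm; have Ty := in_T32_ym.
have TX := T32_X K; have TY := T32_Y K.
have TM := @T32_mul K; have TE := in_T32_exp.
have C := in_T32_tr.
rewrite (tnth_nth 0) /=.
case: i => i /= lti.
do 9 (case: i lti => [|i] lti /=; first by apply: C; auto).
by case: i lti => [|i] //= _; apply: in_C32B; apply: C; auto 6.
Qed.

Lemma in_C32_comp (p : KU K) : in_C32 (p \mPo Uimage K).
Proof.
have C0 : in_C32 (0 : KXY) by rewrite -(mpolyC0 _ K); apply: C32_const.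
have CX n q : in_C32 q -> in_C32 (q ^+ n : KXY).
  move=> Cq; elim: n => [|n IH]; first exact: in_C32_1.
  by rewrite exprS; apply: C32_mul.
rewrite comp_mpolyE; elim/big_ind: _ => // [q r|m _]; first exact: C32_add.
apply: in_C32Z; elim/big_ind: _ => [|q r|i _].
- exact: in_C32_1.
- exact: C32_mul.
- by apply: CX; apply: in_C32_Uimage.
Qed.

Lemma in_T32_pi (z : freeKU K) : in_T32 (pi z).
Proof.
rewrite /pi monalg.mmapE; elim/big_ind: _ => [|A B|f _].
- rewrite -(raddf0 (@scalar_mx KXY 3)) -(mpolyC0 _ K).
  exact/T32_C/C32_const.
- exact: T32_add.
apply: T32_mul; first exact/T32_C/in_C32_comp.
rewrite /word_image; elim/big_ind: _ => [|A B|l _].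
- exact: in_T32_1.
- exact: T32_mul.
case: l; [exact: in_T32_xm|exact: in_T32_ym|apply/T32_C].
apply: in_C32B; apply: in_T32_tr; have Tx := in_T32_xm; have Ty := in_T32_ym;
  by do !apply: T32_mul => //; apply: in_T32_exp.
Qed.

Lemma Ker_piP (z1 z2 z : freeKU K) :
  Ker_pi z -> Ker_pi (z1 * z * z2).
Proof. by rewrite /Ker_pi !rmorphM /= => ->; rewrite mulr0 mul0r. Qed.

End PiTheory.

Definition admissible_order (leU : rel Umon) : Prop :=
  [/\ total leU, transitive leU, antisymmetric leU,
      forall a b c, leU a b -> leU (c + a)%MM (c + b)%MM
    & forall a : nat -> Umon,
        ~ (forall n, (a n.+1 != a n) && leU (a n.+1) (a n))].

Definition letter_deg (l : letter) : nat :=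
  match l with Lx | Ly => 1 | Lw => 6 end.

Definition word_deg (f : word) : nat := (\sum_(l <- f) letter_deg l)%N.

Definition word_lt (f g : word) : bool :=
  (word_deg f < word_deg g)%N ||
  ((word_deg f == word_deg g) &&
   ((map letter_rank f : seqlexi nat) < map letter_rank g)%O).

(* The monomial a f of the free algebra. *)
Notation monomial := (Umon * word)%type.

Definition monomial_lt (leU : rel Umon) (m n : monomial) : bool :=
  word_lt m.2 n.2 || ((m.2 == n.2) && ((m.1 != n.1) && leU m.1 n.1)).

Definition monomial_dvd (m n : monomial) : Prop :=
  exists c h1 h2, n.1 = (c + m.1)%MM /\ n.2 = wcat (wcat h1 m.2) h2.

Section Groebner.
Variable K : fieldType.

Definition monomial_coeff (z : freeKU K) (m : monomial) : K :=
  (monalg.mcoeff m.2 z)@_m.1.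

Definition is_leading (leU : rel Umon) (z : freeKU K) (m : monomial) : Prop :=
  monomial_coeff z m != 0 /\
  forall n, monomial_coeff z n != 0 -> n = m \/ monomial_lt leU n m.

Definition two_sided_ideal (I : freeKU K -> Prop) : Prop :=
  [/\ I 0, forall z1 z2, I z1 -> I z2 -> I (z1 + z2)
    & forall a z b, I z -> I (a * z * b)].

Definition is_Groebner_basis (leU : rel Umon) (B I : freeKU K -> Prop) : Prop :=
  [/\ two_sided_ideal I,
      forall z, B z -> I z
    & forall z, I z -> z != 0 ->
        exists b m n, [/\ B b, is_leading leU b m, is_leading leU z n
                        & monomial_dvd m n]].

End Groebner.

Section Elements.
Variable K : fieldType.

Local Notation KU := (KU K).
Local Notation A := (freeKU K).

Definition disc : KU := u20 * u02 - u11 ^+ 2.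

Definition Delta : KU :=
  \det (\matrix_(i < 3, j < 3)
    nth 0 (nth [::] [:: [:: u20; u11; u02];
                        [:: u30; u21; u12];
                        [:: u21; u12; u03]] i) j).

Definition omega1 : KU := disc ^+ 3.
Definition omega2 : KU := disc ^+ 2 * u22.
Definition omega4 : KU := disc * u22 ^+ 2.
Definition omega7 : KU := u22 ^+ 3.
Definition omega5 : KU := u22 * Delta.
Definition omega3' : KU := disc * Delta.
Definition omega6 : KU :=
  (u30 * u03 - u12 * u21) ^+ 2
  - 4 * (u03 * u21 - u12 ^+ 2) * (u30 * u12 - u21 ^+ 2).
Definition omega3'' : KU :=
  5 * (u02 ^+ 3 * u30 ^+ 2 + u20 ^+ 3 * u03 ^+ 2)
  - 30 * (u02 ^+ 2 * u11 * u21 * u30 + u20 ^+ 2 * u11 * u03 * u12)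
  + 3 * ((4 * u02 * u11 ^+ 2 + u02 ^+ 2 * u20) * (3 * u21 ^+ 2 + 2 * u12 * u30)
         + (4 * u11 ^+ 2 * u20 + u20 ^+ 2 * u02) * (3 * u12 ^+ 2 + 2 * u21 * u03))
  - 2 * (2 * u11 ^+ 3 + 3 * u20 * u11 * u02) * (9 * u12 * u21 + u30 * u03).

Definition comm (a b : A) : A := a * b - b * a.
Definition acomm (a b : A) : A := a * b + b * a.

(* The expression defining F, as a function of its variables, so that the
   substitution giving F' is a permutation of the arguments. *)
Definition Fexpr (u20 u11 u02 u30 u21 u12 u03 u22 : KU) (x1 y1 : A) : A :=
  let U1 := (u11 * u02 * u30 - 2 * u11 ^+ 2 * u21 - u20 * u02 * u21
             + 3 * u20 * u11 * u12 - u20 ^+ 2 * u03)%:A in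
  let U2 := (u20 * u02 - u11 ^+ 2) *: (u20 *: y1 - u11 *: x1) in
  let U3 := u22 *: (u20 *: y1 - u11 *: x1) in
  let U4 := u30 *: (u03 *: x1 - (2 * u12) *: y1)
            - u21 *: (u12 *: x1 - (2 * u21) *: y1) in
  let U5 := u20 *: (u03 *: x1 ^+ 2 - u12 *: acomm x1 y1 + u21 *: y1 ^+ 2)
            - u11 *: (u12 *: x1 ^+ 2 - u21 *: acomm x1 y1 + u30 *: y1 ^+ 2) in
  let U6 := (2 * (u11 * u12 - u02 * u21)) *: x1 ^+ 2
            - (u20 * u12 - u02 * u30) *: acomm x1 y1
            + (2 * (u20 * u21 - u11 * u30)) *: y1 ^+ 2 in
  let U7 := (u20 * u12 - 2 * u11 * u21 + u02 * u30) *: comm x1 y1 in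
  let U8 := (u20 * u02 - u11 ^+ 2) *: (comm x1 y1 * x1) in
  let U10 := (u20 * u02 - u11 ^+ 2) *: comm (x1 ^+ 2) y1 in
  let U11 := u22 *: comm (x1 ^+ 2) y1 in
  let U12 := u30 *: (comm x1 y1 * y1 ^+ 2) - u21 *: (comm x1 y1 * acomm x1 y1)
             + u12 *: (comm x1 y1 * x1 ^+ 2) in
  let U13 := u20 *: (comm x1 y1 ^+ 2 * y1) - u11 *: (comm x1 y1 ^+ 2 * x1) in
  - (4 * U1) - 2 * U2 + 10 * U3 + 18 * U4 - 6 * U5 + 9 * U6 + 15 * U7
  - 4 * U8 - 4 * U10 + 12 * U11 - 36 * U12 + 12 * U13.

Definition F : A := Fexpr u20 u11 u02 u30 u21 u12 u03 u22 x1 y1.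
Definition F' : A := Fexpr u02 u11 u20 u03 u12 u21 u30 u22 y1 x1.

Definition ratio (m n : nat) : K := m%:R / n%:R.

Definition f1 : A := w33 * x1 - x1 * w33.
Definition f2 : A := w33 * y1 - y1 * w33.
Definition f3 : A :=
  w33 ^+ 2 - (ratio 1 27 *: omega1 - ratio 2 9 *: omega2 + ratio 4 15 *: omega3'
              + ratio 1 90 *: omega3'' + ratio 1 3 *: omega4 - ratio 2 3 *: omega5
              - ratio 1 3 *: omega6 - ratio 4 27 *: omega7)%:A.
Definition f4 : A := 18 * (x1 * w33) + F.
Definition f5 : A := - (18 * (y1 * w33)) + F'.
Definition f6 : A := x1 ^+ 3 - (ratio 1 2 *: u20) *: x1 - (ratio 1 3 *: u30)%:A.
Definition f7 : A :=
  x1 ^+ 2 * y1 + x1 * y1 * x1 + y1 * x1 ^+ 2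
  - u11 *: x1 - (ratio 1 2 *: u20) *: y1 - u21%:A.
Definition f8 : A :=
  x1 * y1 ^+ 2 + y1 * x1 * y1 + y1 ^+ 2 * x1
  - (ratio 1 2 *: u02) *: x1 - u11 *: y1 - u12%:A.
Definition f9 : A := y1 ^+ 3 - (ratio 1 2 *: u02) *: y1 - (ratio 1 3 *: u03)%:A.
Definition f10 : A :=
  6 * (x1 * y1) ^+ 2 - 6 * (y1 ^+ 2 * x1 ^+ 2)
  + (3 * u02) *: x1 ^+ 2 - (6 * u11) *: (x1 * y1) + (3 * u20) *: y1 ^+ 2
  + (2 * (- (u20 * u02) + u11 ^+ 2 + u22))%:A.
Definition f11 : A :=
  36 * (y1 ^+ 2 * x1 * y1 * x1 ^+ 2) - (6 * u02) *: (x1 * y1 * x1 ^+ 2)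
  + (12 * u11) *: ((y1 * x1) ^+ 2 - y1 ^+ 2 * x1 ^+ 2)
  - (6 * u20) *: (y1 ^+ 2 * x1 * y1)
  + (12 * u12) *: (x1 * y1 * x1 - y1 * x1 ^+ 2)
  + (12 * u21) *: (y1 * x1 * y1 - y1 ^+ 2 * x1)
  + (- (u20 * u02) + 4 * u11 ^+ 2 + 4 * u22) *: (x1 * y1)
  + (2 * (- (u20 * u02) - 2 * u11 ^+ 2 + 4 * u22)) *: (y1 * x1)
  + (2 * (u20 * u03 - 6 * u11 * u12 + 3 * u02 * u21)) *: x1
  + (2 * (u02 * u30 - 6 * u11 * u21 + 3 * u20 * u12)) *: y1
  + 2 * ((u20 * u11 * u02 - u11 ^+ 3 + u30 * u03 - 3 * u21 * u12
          - u22 * u11)%:A - 3 * w33).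

Definition f_basis : seq A := [:: f1; f2; f3; f4; f5; f6; f7; f8; f9; f10; f11].

End Elements.

(* Main.v *)
(** The leading word of f11 is w33, of degree 6, so only f6, ..., f11 contribute
    divisors: their leading words are xxx, xxy, xyy, yyy, xyxy and w33, and exactly
    18 words, all in x and y, contain none of them.  Rewriting with f6, ..., f11 reduces
    every word modulo Ker(pi) to a K[U]-combination of these normal words without
    raising the order, so the Groebner property amounts to the freeness of their images
    over K[U].

    Freeness: multiply a relation sum p_i(U) b_i = 0 by a word and take traces.
    Transposing both matrices fixes every element of U and sends tr(s) to tr(rev s), so
    the odd parts tr(s) - tr(rev s) satisfy the same relation.  A word of length at
    most 5 is cyclically equivalent to its reversal, and up to rotation xxyyxy and its
    reversal are the only words of length 6 that are not; their odd part is +w or -w.  Hence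
    the odd part of tr(b_i b_j) is antitriangular for a suitable pairing of the 18 words, and
    w p_i(U) = 0 for all i.  The algebraic independence of the ten elements of U follows
    from a specialization in which their leading monomials have linearly independent
    exponents.

    Membership of the f_i in Ker(pi): over the fraction field, conjugate so that x is
    a companion matrix; each f_i is then a polynomial identity in 10 variables. *)

Require Import Defs.
From HB Require Import structures.
From mathcomp Require Import all_boot all_order all_algebra.
From mathcomp Require Import monalg.
From mathcomp Require Import mpoly.
From mathcomp Require Import ring zify.
From Stdlib Require ZArith Ring_theory Ring_polynom InitialRing.

Set Implicit Arguments.
Unset Strict Implicit.
Unset Printing Implicit Defensive.

Import Order.TTheory GRing.Theory.
Local Open Scope ring_scope.

(** * Integer polynomials by reflection *)

Notation Z := BinNums.Z.
Notation Pol := (Ring_polynom.Pol Z).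
Notation Z0 := BinNums.Z0.
Notation Z1 := (BinNums.Zpos BinNums.xH).

(** [Pol] is the sparse Horner form behind the standard [ring] tactic: its operations run under
    [vm_compute], so a large identity becomes a boolean test valid in every commutative ring. [mk_X]
    counts variables from 1, hence [of_succ_nat] in [pvar]. *)
Definition pconst (n : nat) : Pol := Ring_polynom.Pc (BinInt.Z.of_nat n).
Definition pvar (n : nat) : Pol :=
  Ring_polynom.mk_X Z0 Z1 (BinPos.Pos.of_succ_nat n).
Definition padd : Pol -> Pol -> Pol := Ring_polynom.Padd Z0 BinInt.Z.add BinInt.Z.eqb.
Definition pmul : Pol -> Pol -> Pol :=
  Ring_polynom.Pmul Z0 Z1 BinInt.Z.add BinInt.Z.mul BinInt.Z.eqb.
Definition popp : Pol -> Pol := Ring_polynom.Popp BinInt.Z.opp.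
Definition peq : Pol -> Pol -> bool := Ring_polynom.Peq BinInt.Z.eqb.

Section PolEval.
Variables (R : comNzRingType) (env : seq R).

Definition peval : Pol -> R :=
  Ring_polynom.Pphi 0 +%R *%R (InitialRing.gen_phiZ 0 1 +%R *%R -%R) env.

Let Rth : Ring_theory.ring_theory 0 1 +%R *%R (fun x y : R => x - y) -%R eq.
Proof.
split=> //; [exact: add0r|exact: addrC|exact: addrA|exact: mul1r|exact: mulrC
  |exact: mulrA|exact: mulrDl|exact: subrr].
Qed.
Let Rext := Ring_theory.Eq_ext (@GRing.add R) *%R -%R.
Let Seq := Ring_theory.Eqsth R.
Let ARth := Ring_theory.Rth_ARth Seq Rext Rth.
Let phiZ := InitialRing.gen_phiZ_morph Seq Rext Rth.

Lemma pevalD p q : peval (padd p q) = peval p + peval q.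
Proof. exact: (Ring_polynom.Padd_ok Seq Rext ARth phiZ). Qed.

Lemma pevalM p q : peval (pmul p q) = peval p * peval q.
Proof. exact: (Ring_polynom.Pmul_ok Seq Rext ARth phiZ). Qed.

Lemma pevalN p : peval (popp p) = - peval p.
Proof. exact: (Ring_polynom.Popp_ok Seq Rext ARth phiZ). Qed.

Lemma peval_const n : peval (pconst n) = n%:R.
Proof.
rewrite /peval /=; elim: n => [//|n IH].
rewrite Znat.Nat2Z.inj_succ -BinInt.Z.add_1_r.
by rewrite (Ring_theory.morph_add phiZ) IH mulrSr.
Qed.

Lemma peval_eq p q : peq p q -> peval p = peval q.
Proof. exact (fun pq => Ring_polynom.Peq_ok Seq Rext phiZ p q pq env). Qed.

End PolEval.

Notation pmat := (seq (seq Pol)).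
Definition pent (a : pmat) i j : Pol := nth (pconst 0) (nth [::] a i) j.
Definition pmx (f : nat -> nat -> Pol) : pmat := mkseq (fun i => mkseq (f i) 3) 3.
Definition pmxD a b := pmx (fun i j => padd (pent a i j) (pent b i j)).
Definition pmxN a := pmx (fun i j => popp (pent a i j)).
Definition pmxZ p a := pmx (fun i j => pmul p (pent a i j)).
Definition pmxC p := pmx (fun i j => if i == j then p else pconst 0).
Definition pmxM a b := pmx (fun i j =>
  padd (pmul (pent a i 0) (pent b 0 j))
    (padd (pmul (pent a i 1) (pent b 1 j)) (pmul (pent a i 2) (pent b 2 j)))).
Definition pmxtr a := padd (pent a 0 0) (padd (pent a 1 1) (pent a 2 2)).
Definition pmx_eq a b := all (fun i => all (fun j => peq (pent a i j) (pent b i j))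
  (iota 0 3)) (iota 0 3).

Definition pmx_of (R : comNzRingType) (env : seq R) (a : pmat) : 'M[R]_3 :=
  \matrix_(i, j) peval env (pent a i j).

Section PmatEval.
Variables (R : comNzRingType) (env : seq R).
Local Notation ev := (pmx_of env).

Lemma pent_mx f (i j : 'I_3) : pent (pmx f) i j = f i j.
Proof. by rewrite /pent /pmx !nth_mkseq. Qed.

Lemma pmx_ofD a b : ev (pmxD a b) = ev a + ev b.
Proof. by apply/matrixP=> i j; rewrite !mxE pent_mx pevalD. Qed.

Lemma pmx_ofN a : ev (pmxN a) = - ev a.
Proof. by apply/matrixP=> i j; rewrite !mxE pent_mx pevalN. Qed.

Lemma pmx_ofC p : ev (pmxC p) = (peval env p)%:M.
Proof.
apply/matrixP=> i j; rewrite !mxE pent_mx; have [->|ij] := eqVneq i j; first by rewrite eqxx.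
by rewrite ifN ?peval_const.
Qed.

Lemma pmx_ofZ p a : ev (pmxZ p a) = peval env p *: ev a.
Proof. by apply/matrixP=> i j; rewrite !mxE pent_mx pevalM. Qed.

Lemma pmx_ofM a b : ev (pmxM a b) = ev a * ev b.
Proof.
apply/matrixP=> i j; rewrite !mxE pent_mx !pevalD !pevalM.
by rewrite !big_ord_recl big_ord0 addr0 !mxE.
Qed.

Lemma pmx_oftr a : \tr (ev a) = peval env (pmxtr a).
Proof. by rewrite /mxtrace !big_ord_recl big_ord0 addr0 !mxE !pevalD. Qed.

Lemma pmx_of_eq a b : pmx_eq a b -> ev a = ev b.
Proof.
move=> /allP ab; apply/matrixP=> i j; rewrite !mxE; apply: peval_eq.
have iota3 (k : 'I_3) : val k \in iota 0 3 by rewrite mem_iota ltn_ord.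
by have /allP/(_ _ (iota3 j)) := ab _ (iota3 i).
Qed.

End PmatEval.

(** * Evaluation of the free algebra at a pair of matrices *)

Section Evaluation.
Variables (K : fieldType) (R : comNzRingType) (iota : {rmorphism K -> R}).
Variables (U : 'I_10 -> R) (L : letter -> 'M[R]_3).

Definition evalU (p : KU K) : R := mpoly.mmap iota U p.
Definition evalCU (p : KU K) : 'M[R]_3 := (evalU p)%:M.
Definition eval_word (f : word) : 'M[R]_3 := \prod_(l <- f) L l.
Definition eval (z : freeKU K) : 'M[R]_3 := monalg.mmap evalCU eval_word z.

HB.instance Definition _ := GRing.RMorphism.copy evalU (mpoly.mmap iota U).
HB.instance Definition _ := GRing.RMorphism.copy evalCU (@scalar_mx R 3 \o evalU).

Lemma eval_word_is_mmorphism : monalg.mmorphism eval_word.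
Proof.
split=> [f g|]; rewrite /eval_word.
  by rewrite monalg.fmM big_cat.
by rewrite monalg.fm1 big_nil.
Qed.
HB.instance Definition _ :=
  monalg.isMultiplicative.Build word 'M[R]_3 eval_word eval_word_is_mmorphism.

Lemma eval_is_additive : additive eval.
Proof. exact: monalg.mmap_is_additive. Qed.
HB.instance Definition _ :=
  GRing.isAdditive.Build (freeKU K) 'M[R]_3 eval eval_is_additive.

Lemma eval_is_multiplicative : multiplicative eval.
Proof.
apply: monalg.commr_mmap_is_multiplicative => z f g.
exact/comm_mx_sym/comm_mx_scalar.
Qed.
HB.instance Definition _ :=
  GRing.isMultiplicative.Build (freeKU K) 'M[R]_3 eval eval_is_multiplicative.

Lemma evalZ p z : eval (p *: z) = evalU p *: eval z.
Proof. by rewrite /eval monalg.mmapZ /evalCU /= -mulmxE mul_scalar_mx. Qed.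

Lemma eval_lvar l : eval (lvar K l) = L l.
Proof.
rewrite /eval /lvar monalg.mmapU /= rmorph1 mul1r.
by rewrite /eval_word monalg.fmU big_seq1.
Qed.

Section Reify.
Variable env : seq R.

(** The second argument is left as an existential variable and is built by unification while
    [reify_step] descends through the expression. *)
Definition reifU (p : KU K) q := evalU p = peval env q.
Definition reif (z : freeKU K) a := eval z = pmx_of env a.

Definition pexp p n := iter n (pmul p) (pconst 1).
Definition pmxX a n := iter n (pmxM a) (pmxC (pconst 1)).

Lemma reifUD p1 p2 q1 q2 : reifU p1 q1 -> reifU p2 q2 -> reifU (p1 + p2) (padd q1 q2).
Proof. by move=> e1 e2; rewrite /reifU rmorphD pevalD -e1 -e2. Qed.
Lemma reifUM p1 p2 q1 q2 : reifU p1 q1 -> reifU p2 q2 -> reifU (p1 * p2) (pmul q1 q2).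
Proof. by move=> e1 e2; rewrite /reifU rmorphM pevalM -e1 -e2. Qed.
Lemma reifUN p q : reifU p q -> reifU (- p) (popp q).
Proof. by move=> e; rewrite /reifU rmorphN pevalN -e. Qed.
Lemma reifU_nat n : reifU n%:R (pconst n).
Proof. by rewrite /reifU rmorph_nat peval_const. Qed.
Lemma reifUX p q n : reifU p q -> reifU (p ^+ n) (pexp q n).
Proof.
move=> e; rewrite /reifU rmorphXn /= e.
by elim: n => [|n IH]; rewrite ?peval_const // exprS IH /= pevalM.
Qed.

Lemma reifUMn p q n : reifU p q -> reifU (p *+ n) (pmul (pconst n) q).
Proof. by move=> e; rewrite /reifU rmorphMn /= e pevalM peval_const mulr_natl. Qed.

Lemma reifD z1 z2 a1 a2 : reif z1 a1 -> reif z2 a2 -> reif (z1 + z2) (pmxD a1 a2).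
Proof. by move=> e1 e2; rewrite /reif rmorphD pmx_ofD -e1 -e2. Qed.
Lemma reifM z1 z2 a1 a2 : reif z1 a1 -> reif z2 a2 -> reif (z1 * z2) (pmxM a1 a2).
Proof. by move=> e1 e2; rewrite /reif rmorphM pmx_ofM -e1 -e2. Qed.
Lemma reifN z a : reif z a -> reif (- z) (pmxN a).
Proof. by move=> e; rewrite /reif rmorphN pmx_ofN -e. Qed.
Lemma reif_nat n : reif n%:R (pmxC (pconst n)).
Proof. by rewrite /reif rmorph_nat pmx_ofC peval_const raddfMn. Qed.
Lemma reif1 : reif 1 (pmxC (pconst 1)).
Proof. exact: (reif_nat 1). Qed.
Lemma reifX z a n : reif z a -> reif (z ^+ n) (pmxX a n).
Proof.
move=> e; rewrite /reif rmorphXn /= e.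
by elim: n => [|n IH]; rewrite ?pmx_ofC ?peval_const // exprS IH /= pmx_ofM.
Qed.
Lemma reifZ p z q a : reifU p q -> reif z a -> reif (p *: z) (pmxZ q a).
Proof. by rewrite /reif evalZ pmx_ofZ => -> ->. Qed.

(** [Pol] has integer coefficients only, so the quotient [q'] is supplied and m q = n q' is tested
    over the integers; n is then cancelled in [K]. *)
Lemma reifU_ratio m n p q q' : n%:R != 0 :> K -> reifU p q ->
  peq (pmul (pconst m) q) (pmul (pconst n) q') -> reifU (Defs.ratio K m n *: p) q'.
Proof.
move=> n0 e /(peval_eq env); rewrite !pevalM !peval_const -e => mn.
rewrite /reifU /evalU mmapZ rmorphM rmorph_nat mulrAC mn mulrAC -(rmorph_nat iota).
by rewrite -rmorphM divff // rmorph1 mul1r.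
Qed.

Lemma reif_eq0 z a : reif z a -> pmx_eq a (pmxC (pconst 0)) -> eval z = 0.
Proof.
by move=> -> /pmx_of_eq ->; rewrite pmx_ofC peval_const raddf0.
Qed.

End Reify.
End Evaluation.

Ltac reify_step :=
  lazymatch goal with
  | |- reif _ _ _ _ (_ + _) _ => eapply reifD
  | |- reif _ _ _ _ (- _) _ => eapply reifN
  | |- reif _ _ _ _ (_ * _) _ => eapply reifM
  | |- reif _ _ _ _ (_ *: _) _ => eapply reifZ
  | |- reif _ _ _ _ (_ ^+ _) _ => eapply reifX
  | |- reif _ _ _ _ _%:R _ => eapply reif_nat
  | |- reif _ _ _ _ 1 _ => eapply reif1
  | |- reifU _ _ _ (_ + _) _ => eapply reifUD
  | |- reifU _ _ _ (- _) _ => eapply reifUN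
  | |- reifU _ _ _ (_ * _) _ => eapply reifUM
  | |- reifU _ _ _ (_ ^+ _) _ => eapply reifUX
  | |- reifU _ _ _ _%:R _ => eapply reifU_nat
  | |- reifU _ _ _ (_ *+ _) _ => eapply reifUMn
  | _ => match goal with
         | H : reif _ _ _ _ ?z1 _ |- reif _ _ _ _ ?z2 _ => constr_eq z1 z2; exact H
         | H : reifU _ _ _ ?p1 _ |- reifU _ _ _ ?p2 _ => constr_eq p1 p2; exact H
         end
  end.

(* Exact only when [n] divides all coefficients, which [reifU_ratio] checks. *)
Fixpoint pdiv (n : Z) (p : Pol) : Pol :=
  match p with
  | Ring_polynom.Pc c => Ring_polynom.Pc (BinInt.Z.div c n)
  | Ring_polynom.Pinj j q => Ring_polynom.Pinj j (pdiv n q)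
  | Ring_polynom.PX q j r => Ring_polynom.PX (pdiv n q) j (pdiv n r)
  end.
Definition pdivn n p := pdiv (BinInt.Z.of_nat n) p.

Lemma det_mx33 (R : comNzRingType) (f : nat -> nat -> R) :
  \det (\matrix_(i < 3, j < 3) f i j) =
  f 0%N 0%N * (f 1%N 1%N * f 2 2 - f 1%N 2 * f 2 1%N)
  - f 0%N 1%N * (f 1%N 0%N * f 2 2 - f 1%N 2 * f 2 0%N)
  + f 0%N 2 * (f 1%N 0%N * f 2 1%N - f 1%N 1%N * f 2 0%N).
Proof.
rewrite (expand_det_row _ ord0) !big_ord_recl big_ord0 /cofactor.
do 3 rewrite (expand_det_row _ ord0) !big_ord_recl big_ord0 /cofactor !det_mx11.
by rewrite !mxE /= /bump /=; ring.
Qed.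

Lemma DeltaE (K : fieldType) : Delta K =
  u20 * (u21 * u03 - u12 * u12) - u11 * (u30 * u03 - u12 * u21)
  + u02 * (u30 * u12 - u21 * u21).
Proof. exact: (det_mx33 (fun i j => nth 0 (nth [::] _ i) j)). Qed.

(** 270 is the least common multiple of the denominators in [f3]; with a single ratio left,
    [reifU_ratio] is applied only once. *)
Lemma f3_commonE (K : fieldType) (V : lmodType K) (a b c d e f g h : V) :
  [pchar K] =i pred0 ->
  Defs.ratio K 1 27 *: a - Defs.ratio K 2 9 *: b + Defs.ratio K 4 15 *: c
  + Defs.ratio K 1 90 *: d + Defs.ratio K 1 3 *: e - Defs.ratio K 2 3 *: f
  - Defs.ratio K 1 3 *: g - Defs.ratio K 4 27 *: h
  = Defs.ratio K 1 270 *: (a *+ 10 - b *+ 60 + c *+ 72 + d *+ 3 + e *+ 90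
                           - f *+ 180 - g *+ 90 - h *+ 40).
Proof.
move=> /pcharf0P charK0.
have wd k m n l (v : V) : (k * n)%N = 270%N -> (k * m)%N = l ->
    Defs.ratio K 1 270 *: (v *+ l) = Defs.ratio K m n *: v.
  move=> kn <-; rewrite -scaler_nat scalerA; congr (_ *: _).
  have : (k * n)%:R != 0 :> K by rewrite charK0 kn.
  rewrite /Defs.ratio -kn !natrM mulf_eq0 negb_or => /andP[k0 n0].
  by rewrite mul1r invfM mulrACA mulVf // mul1r mulrC.
rewrite 3!scalerBr 3!scalerDr scalerBr.
rewrite (wd 10%N 1%N 27%N 10%N) // (wd 30%N 2%N 9%N 60%N) // (wd 18%N 4%N 15%N 72%N) //.
rewrite (wd 3%N 1%N 90%N 3%N) // !(wd 90%N 1%N 3%N 90%N) // (wd 90%N 2%N 3%N 180%N) //.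
by rewrite (wd 10%N 4%N 27%N 40%N).
Qed.

(* Variables 0 and 1 are the coefficients of a traceless companion matrix [x], variables
   2 to 9 the entries of a traceless matrix [y]. *)
Definition comp_x : pmat :=
  [:: [:: pconst 0; pconst 0; pvar 0]; [:: pconst 1; pconst 0; pvar 1];
      [:: pconst 0; pconst 1; pconst 0]].
Definition gen_y : pmat :=
  [:: [:: pvar 2; pvar 3; pvar 4]; [:: pvar 5; pvar 6; pvar 7];
      [:: pvar 8; pvar 9; popp (padd (pvar 2) (pvar 6))]].
Definition comp_xx := pmxM comp_x comp_x.
Definition gen_yy := pmxM gen_y gen_y.
Definition comp_xy := pmxM comp_x gen_y.
Definition comp_yx := pmxM gen_y comp_x.
Definition comp_xxyy := pmxM comp_xx gen_yy.
Definition pu20 := pmxtr comp_xx.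
Definition pu11 := pmxtr comp_xy.
Definition pu02 := pmxtr gen_yy.
Definition pu30 := pmxtr (pmxM comp_xx comp_x).
Definition pu21 := pmxtr (pmxM comp_xx gen_y).
Definition pu12 := pmxtr (pmxM comp_x gen_yy).
Definition pu03 := pmxtr (pmxM gen_yy gen_y).
Definition pu22 := padd (pmxtr comp_xxyy) (popp (pmxtr (pmxM comp_xy comp_xy))).
Definition pw := padd (pmxtr (pmxM comp_xxyy comp_xy))
  (popp (pmxtr (pmxM (pmxM gen_yy comp_xx) comp_yx))).

(** * The eleven identities for a companion matrix and a traceless matrix *)

Section Identities.
Variables (K : fieldType) (R : comNzRingType) (iota : {rmorphism K -> R}).
Variables (U : 'I_10 -> R) (L : letter -> 'M[R]_3) (env : seq R).
Local Notation reif := (reif iota U L env).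
Local Notation reifU := (reifU iota U env).
Hypothesis charK0 : [pchar K] =i pred0.
Hypotheses (rx : reif x1 comp_x) (ry : reif y1 gen_y) (rw : reif w33 (pmxC pw)).
Hypotheses (r20 : reifU u20 pu20) (r11 : reifU u11 pu11) (r02 : reifU u02 pu02)
  (r30 : reifU u30 pu30) (r21 : reifU u21 pu21) (r12 : reifU u12 pu12)
  (r03 : reifU u03 pu03) (r22 : reifU u22 pu22).
Local Notation ev := (eval iota U L).

Let nat_neq0 n : n.+1%:R != 0 :> K.
Proof. by have /pcharf0P -> := charK0. Qed.

Lemma eval_f1 : ev (f1 K) = 0.
Proof. by rewrite /f1; eapply reif_eq0; [repeat reify_step | vm_compute]. Qed.

Lemma eval_f2 : ev (f2 K) = 0.
Proof. by rewrite /f2; eapply reif_eq0; [repeat reify_step | vm_compute]. Qed.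

Lemma eval_f4 : ev (f4 K) = 0.
Proof.
rewrite /f4 /F /Fexpr /comm /acomm.
by eapply reif_eq0; [repeat reify_step | vm_compute].
Qed.

Lemma eval_f5 : ev (f5 K) = 0.
Proof.
rewrite /f5 /F' /Fexpr /comm /acomm.
by eapply reif_eq0; [repeat reify_step | vm_compute].
Qed.

Lemma eval_f10 : ev (f10 K) = 0.
Proof. by rewrite /f10; eapply reif_eq0; [repeat reify_step | vm_compute]. Qed.

Lemma eval_f11 : ev (f11 K) = 0.
Proof. by rewrite /f11; eapply reif_eq0; [repeat reify_step | vm_compute]. Qed.

Lemma eval_f6 : ev (f6 K) = 0.
Proof.
have r20' := reifU_ratio (m := 1) (q' := pdivn 2 pu20) (nat_neq0 1) r20 isT.
have r30' := reifU_ratio (m := 1) (q' := pdivn 3 pu30) (nat_neq0 2) r30 isT.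
by rewrite /f6; eapply reif_eq0; [repeat reify_step | vm_compute].
Qed.

Lemma eval_f9 : ev (f9 K) = 0.
Proof.
have r02' := reifU_ratio (m := 1) (q' := pdivn 2 pu02) (nat_neq0 1) r02 isT.
have r03' := reifU_ratio (m := 1) (q' := pdivn 3 pu03) (nat_neq0 2) r03 isT.
by rewrite /f9; eapply reif_eq0; [repeat reify_step | vm_compute].
Qed.

Lemma eval_f7 : ev (f7 K) = 0.
Proof.
have r20' := reifU_ratio (m := 1) (q' := pdivn 2 pu20) (nat_neq0 1) r20 isT.
by rewrite /f7; eapply reif_eq0; [repeat reify_step | vm_compute].
Qed.

Lemma eval_f8 : ev (f8 K) = 0.
Proof.
have r02' := reifU_ratio (m := 1) (q' := pdivn 2 pu02) (nat_neq0 1) r02 isT.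
by rewrite /f8; eapply reif_eq0; [repeat reify_step | vm_compute].
Qed.

Lemma eval_f3 : ev (f3 K) = 0.
Proof.
rewrite /f3 f3_commonE // /omega1 /omega2 /omega3' /omega3'' /omega4 /omega5 /omega6 /omega7.
rewrite DeltaE /disc; eapply reif_eq0.
  eapply reifD; [repeat reify_step|eapply reifN].
  eapply reifZ; [|eapply reif1].
  (* The bracket of [f3] must equal the square of w, so that square serves as the quotient by
     270. *)
  apply: (@reifU_ratio _ _ _ _ _ 1 270 _ _ (pmul pw pw));
    [exact: nat_neq0|repeat reify_step|by vm_compute].
by vm_compute.
Qed.

Lemma eval_f_basis z : z \in f_basis K -> ev z = 0.
Proof.
rewrite /f_basis !inE => /or4P[/eqP->|/eqP->|/eqP->|];
  [exact: eval_f1|exact: eval_f2|exact: eval_f3|].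
case/or4P=> [/eqP->|/eqP->|/eqP->|]; [exact: eval_f4|exact: eval_f5|exact: eval_f6|].
case/or4P=> [/eqP->|/eqP->|/eqP->|]; [exact: eval_f7|exact: eval_f8|exact: eval_f9|].
by case/orP=> /eqP->; [exact: eval_f10|exact: eval_f11].
Qed.

End Identities.

(** * Reduction to a companion matrix *)

(** Scalars commute with conjugation, and inside a word each [P] cancels against the following
    [invmx P]. *)
Lemma eval_conj (K : fieldType) (R : comUnitRingType) (iota : {rmorphism K -> R}) U L
    (P : 'M[R]_3) (z : freeKU K) : P \in unitmx ->
  eval iota U (fun l => invmx P *m L l *m P) z = invmx P *m eval iota U L z *m P.
Proof.
move=> uP; rewrite /eval !monalg.mmapE mulmx_sumr mulmx_suml.
apply: eq_bigr => f _; rewrite /evalCU -!mulmxE !mul_scalar_mx -scalemxAr -scalemxAl.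
congr (_ *: _); rewrite /eval_word; elim: (fmonom_val f) => [|l s IH].
  by rewrite !big_nil mulmx1 mulVmx.
by rewrite !big_cons IH -!mulmxE !mulmxA mulmxK.
Qed.

Section MapPi.
Variables (K : fieldType) (R : comNzRingType).
Local Notation KXY := {mpoly K[3 * 3 + 3 * 3]}.
Variable g : {rmorphism KXY -> R}.
Local Notation iota := (g \o @mpolyC (3 * 3 + 3 * 3) K).
Local Notation gU := (g \o tnth (Uimage K)).

(** Serves three morphisms: the embedding into the fraction field, the specialization proving
    algebraic independence, and transposition. *)
Lemma map_comp_Uimage (p : KU K) : g (p \mPo Uimage K) = evalU iota gU p.
Proof.
rewrite /comp_mpoly /evalU /mmap rmorph_sum; apply: eq_bigr => m _.
rewrite rmorphM rmorph_prod; congr (_ * _); apply: eq_bigr => i _.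
by rewrite rmorphXn.
Qed.

Lemma map_pi (z : freeKU K) :
  map_mx g (Defs.pi z) = eval iota gU (fun l => map_mx g (letter_image K l)) z.
Proof.
rewrite /Defs.pi /eval !monalg.mmapE raddf_sum; apply: eq_bigr => f _ /=.
rewrite rmorphM /= map_scalar_mx map_comp_Uimage; congr (_ * _).
by rewrite /word_image rmorph_prod.
Qed.

End MapPi.

(** * Specialization of the generic matrices *)

Section Specialization.
Variables (K : fieldType) (R : comNzRingType) (iota : {rmorphism K -> R}).
Local Notation KXY := {mpoly K[3 * 3 + 3 * 3]}.
Variables X Y : 'M[R]_3.

(** The concatenation follows the numbering of the 18 variables by [lshift], [rshift] and
    [mxvec_index] in [genX] and [genY]. *)
Definition spec_var (k : 'I_(3 * 3 + 3 * 3)) : R := row_mx (mxvec X) (mxvec Y) 0 k.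
Definition spec : KXY -> R := mpoly.mmap iota spec_var.
HB.instance Definition _ := GRing.RMorphism.copy spec (mpoly.mmap iota spec_var).

Lemma specC c : spec c%:MP = iota c. Proof. exact: mmapC. Qed.
Lemma specZ c p : spec (c *: p) = iota c * spec p. Proof. exact: mmapZ. Qed.

Lemma spec_genX : map_mx spec (genX K) = X.
Proof.
by apply/matrixP=> i j; rewrite !mxE /spec mmapX mmap1U /spec_var row_mxEl mxvecE.
Qed.

Lemma spec_genY : map_mx spec (genY K) = Y.
Proof.
by apply/matrixP=> i j; rewrite !mxE /spec mmapX mmap1U /spec_var row_mxEr mxvecE.
Qed.

Lemma spec_trless A :
  map_mx spec (trless A) = map_mx spec A - (iota 3%:R^-1 * \tr (map_mx spec A))%:M.
Proof.
rewrite /trless raddfB /= map_scalar_mx /= specZ; congr (_ - (_ * _)%:M).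
by rewrite /mxtrace rmorph_sum; apply: eq_bigr => i _; rewrite mxE.
Qed.

End Specialization.

(** Values of the ten variables of [comp_x] and [gen_y], where x^3 = b x + c; the last diagonal
    entry of [A] is recovered from its trace being zero. *)
Definition traceless_env (R : comNzRingType) (b c : R) (A : 'M[R]_3) : seq R :=
  [:: c; b; A 0 0; A 0 1; A 0 2; A 1 0; A 1 1; A 1 2; A 2 0; A 2 1].

Section Traceless.
Variables (R : comNzRingType) (b c : R) (A : 'M[R]_3).
Local Notation ev := (pmx_of (traceless_env b c A)).

Lemma pmx_of_gen_y : \tr A = 0 -> ev gen_y = A.
Proof.
move=> trA; have A22 : A ord_max ord_max = - (A 0 0 + A 1 1).
  move: trA; rewrite /mxtrace !big_ord_recl big_ord0 addr0 addrA addrC => /eqP.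
  rewrite addr_eq0 => /eqP; congr (A _ _ = - (_ + A _ _)); exact: val_inj.
apply/matrixP=> -[[|[|[|//]]] ?] [[|[|[|//]]] ?]; rewrite mxE /= ?mul1r ?mulN1r ?addr0;
  try by congr (A _ _); apply: val_inj.
by rewrite -opprD -A22; congr (A _ _); apply: val_inj.
Qed.

(** Cayley-Hamilton for trace zero, with coefficients expressed by traces of powers and multiplied
    by 6 to stay integral. A traceless matrix is [gen_y] at its own entries, so reflection proves
    it. *)
Lemma traceless_cayley : \tr A = 0 ->
  6%:R *: A ^+ 3 = (3%:R * \tr (A ^+ 2)) *: A + (2%:R * \tr (A ^+ 3))%:M.
Proof.
move=> /pmx_of_gen_y; move: (traceless_env b c A) => e <-.
rewrite !exprS expr0 mulr1 -!pmx_ofM !pmx_oftr -!(peval_const e) -!pevalM.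
rewrite -pmx_ofC -!pmx_ofZ -pmx_ofD; apply: pmx_of_eq; by vm_compute.
Qed.

(* The matrix with columns e, x e, x^2 e conjugates [x] into companion form. *)
Lemma krylov_comp_x (x : 'M[R]_3) : x ^+ 3 = b *: x + c%:M ->
  let P : 'M[R]_3 := \matrix_(i, j) (x ^+ j) i 0 in x *m P = P *m ev comp_x.
Proof.
move=> x3 P; have PE i k : P i k = (x ^+ k) i 0 by rewrite mxE.
have CE k j : ev comp_x k j = peval (traceless_env b c A) (pent comp_x k j) by rewrite mxE.
apply/matrixP=> i j; have -> : (x *m P) i j = (x ^+ j.+1) i 0.
  by rewrite exprS -mulmxE !mxE; apply: eq_bigr => k _; rewrite PE.
rewrite mxE !big_ord_recl big_ord0 addr0 !PE !CE.
case: j => -[|[|[|//]]] ? /=; rewrite ?mul1r ?addr0 ?mulr0 ?mulr1 ?add0r ?addr0 //.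
by rewrite x3 expr0 expr1 !mxE addrC mulr_natl [b * _]mulrC.
Qed.

End Traceless.

Section Conjugation.
Variables (R : comUnitRingType) (P : 'M[R]_3).
Hypothesis uP : P \in unitmx.
Definition conjmx3 (A : 'M[R]_3) : 'M[R]_3 := invmx P *m A *m P.

Lemma conjmx3M A B : conjmx3 (A * B) = conjmx3 A * conjmx3 B.
Proof. by rewrite /conjmx3 -!mulmxE !mulmxA mulmxK. Qed.

Lemma mxtrace_conjmx3 A : \tr (conjmx3 A) = \tr A.
Proof. by rewrite /conjmx3 -mulmxA mxtrace_mulC -mulmxA mulmxV // mulmx1. Qed.

End Conjugation.

Section Cyclic.
Variables (K F : fieldType) (iota : {rmorphism K -> F}).
Variables (U : 'I_10 -> F) (L : letter -> 'M[F]_3) (w : F).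
Hypothesis charK0 : [pchar K] =i pred0.
Local Notation x := (L Lx).
Local Notation y := (L Ly).
Hypotheses (tr_x : \tr x = 0) (tr_y : \tr y = 0) (wE : L Lw = w%:M).
Hypotheses (U20 : U (inord 2) = \tr (x ^+ 2)) (U11 : U (inord 3) = \tr (x * y))
  (U02 : U (inord 4) = \tr (y ^+ 2)) (U30 : U (inord 5) = \tr (x ^+ 3))
  (U21 : U (inord 6) = \tr (x ^+ 2 * y)) (U12 : U (inord 7) = \tr (x * y ^+ 2))
  (U03 : U (inord 8) = \tr (y ^+ 3))
  (U22 : U (inord 9) = \tr (x ^+ 2 * y ^+ 2) - \tr (x * y * x * y))
  (w33E : w = \tr (x ^+ 2 * y ^+ 2 * x * y) - \tr (y ^+ 2 * x ^+ 2 * y * x)).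
Local Notation P := (\matrix_(i, j) (x ^+ j) i 0 : 'M[F]_3).

(** If the first basis vector is cyclic for x, conjugation by [P] makes x a companion matrix and
    preserves all traces, hence the values of U and w; the identities for [comp_x] and [gen_y] then
    apply. *)
Lemma eval_f_basis_cyclic z : P \in unitmx -> z \in f_basis K -> eval iota U L z = 0.
Proof.
move=> uP fz; suff: eval iota U (fun l => invmx P *m L l *m P) z = 0.
  rewrite eval_conj // => /(congr1 (fun A => P *m A *m invmx P)).
  by rewrite !mulmxA mulmxK // mulmxV // mul1mx mulmx0 mul0mx.
have nF n : n.+1%:R != 0 :> F.
  by rewrite -(rmorph_nat iota) fmorph_eq0; have /pcharf0P -> := charK0.
pose c := 3%:R^-1 * \tr (x ^+ 3); pose b := 2%:R^-1 * \tr (x ^+ 2).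
have x3 : x ^+ 3 = b *: x + c%:M.
  have d2 : 6%:R * 2%:R^-1 = 3%:R :> F by rewrite -[6%N]/(3 * 2)%N natrM mulfK.
  have d3 : 6%:R * 3%:R^-1 = 2%:R :> F by rewrite -[6%N]/(2 * 3)%N natrM mulfK.
  (* [nF] is shifted by one: [nF 5] makes the factor 6 of [traceless_cayley] cancellable. *)
  apply: (scalerI (nF 5)); rewrite (traceless_cayley 0 0) // scalerDr scalerA scale_scalar_mx.
  by rewrite !mulrA d2 d3.
pose y' := conjmx3 P y; have tr_y' : \tr y' = 0 by rewrite mxtrace_conjmx3.
pose env := traceless_env b c y'.
have yE : conjmx3 P y = pmx_of env gen_y by rewrite pmx_of_gen_y.
have xE : conjmx3 P x = pmx_of env comp_x.
  by rewrite /conjmx3 -mulmxA (krylov_comp_x y' x3) mulmxA mulVmx // mul1mx.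
have cM := conjmx3M uP.
have trE A : \tr A = \tr (conjmx3 P A) by rewrite mxtrace_conjmx3.
have exx : conjmx3 P (x ^+ 2) = pmx_of env comp_xx by rewrite conjmx3M // xE -pmx_ofM.
have eyy : conjmx3 P (y ^+ 2) = pmx_of env gen_yy by rewrite conjmx3M // yE -pmx_ofM.
have evar i : evalU iota U (uvar K i) = U (inord i).
  by rewrite /evalU /uvar mmapX mmap1U.
apply: (@eval_f_basis K F iota U _ env) => //; rewrite /reif /reifU ?evar.
- by rewrite eval_lvar -xE.
- by rewrite eval_lvar -yE.
- rewrite eval_lvar wE pmx_ofC mul_mx_scalar -scalemxAl mulVmx // scalemx1 w33E.
  (* Products are bracketed as in [pw], so that conjugating factor by factor yields the reflected
     matrices. *)
  rewrite -(mulrA (x ^+ 2 * y ^+ 2)) -(mulrA (y ^+ 2 * x ^+ 2)).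
  rewrite (trE (x ^+ 2 * _ * _)) (trE (y ^+ 2 * _ * _)) (cM (x ^+ 2 * y ^+ 2))
    (cM (y ^+ 2 * x ^+ 2)).
  rewrite (cM (x ^+ 2)) (cM (y ^+ 2)) exx eyy (cM x) (cM y) xE yE.
  by rewrite -!pmx_ofM !pmx_oftr -pevalN -pevalD.
- by rewrite U20 trE exx pmx_oftr.
- by rewrite U11 trE conjmx3M // xE yE -pmx_ofM pmx_oftr.
- by rewrite U02 trE eyy pmx_oftr.
- by rewrite U30 exprSr trE conjmx3M // exx xE -pmx_ofM pmx_oftr.
- by rewrite U21 trE conjmx3M // exx yE -pmx_ofM pmx_oftr.
- by rewrite U12 trE conjmx3M // eyy xE -pmx_ofM pmx_oftr.
- by rewrite U03 exprSr trE conjmx3M // eyy yE -pmx_ofM pmx_oftr.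
- rewrite U22 -(mulrA (x * y)) (trE (x ^+ 2 * _)) (trE (x * y * _)) (cM (x * y)).
  rewrite (cM (x ^+ 2)) exx eyy (cM x) xE yE.
  by rewrite -!pmx_ofM !pmx_oftr -pevalN -pevalD.
Qed.

End Cyclic.

(** * Membership of the generators in the kernel *)

Section Kernel.
Variable K : fieldType.
Hypothesis charK0 : [pchar K] =i pred0.
Local Notation KXY := {mpoly K[3 * 3 + 3 * 3]}.

Let nat_neq0 n : n.+1%:R != 0 :> K.
Proof. by have /pcharf0P -> := charK0. Qed.

Lemma mxtrace_trless (A : 'M[KXY]_3) : \tr (trless A) = 0.
Proof.
rewrite /trless raddfB /= mxtrace_scalar scalerMnl -mulr_natr mulVf //.
by rewrite scale1r subrr.
Qed.

Definition rot3 (R : comNzRingType) : 'M[R]_3 := \matrix_(i, j) ((i : nat) == (j.+1 %% 3)%N)%:R.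

Lemma tnth_Uimage i : (i < 10)%N -> tnth (Uimage K) (inord i) = (Uimage K)`_i.
Proof. by move=> lti; rewrite (tnth_nth 0) inordK. Qed.

(** At X = [rot3], a cyclic permutation matrix and hence traceless, the powers of x carry the first
    basis vector through the whole basis: the matrix becomes the identity, so the generic
    determinant is not zero. *)
Lemma det_krylov_neq0 : \det (\matrix_(i, j) (xm K ^+ j) i 0 : 'M_3) != 0.
Proof.
pose s : {rmorphism KXY -> K} := spec (idfun : {rmorphism K -> K}) (rot3 K) 0.
have sx : map_mx s (xm K) = rot3 K.
  rewrite /xm spec_trless spec_genX /mxtrace big1 ?mulr0 ?raddf0 ?oppr0 ?addr0 // => i _.
  by rewrite mxE; case: i => -[|[|[|]]].
apply/eqP => /(congr1 s); rewrite -det_map_mx rmorph0.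
have -> : map_mx s (\matrix_(i, j) (xm K ^+ j) i 0) = 1%:M :> 'M_3.
  apply/matrixP=> i j; rewrite !mxE.
  have -> : s ((xm K ^+ j) i 0) = (rot3 K ^+ j) i 0 by rewrite -sx -rmorphXn /= [RHS]mxE.
  case: j => -[|[|[|//]]] ? /=; rewrite ?expr0 ?expr1 ?mxE.
  - done.
  - by case: i => -[|[|[|]]].
  - rewrite !big_ord_recl big_ord0 !mxE; case: i => -[|[|[|//]]] ?;
      by rewrite /= ?mul0r ?mul1r ?mulr1 ?addr0 ?add0r.
by rewrite det1 => /eqP; rewrite oner_eq0.
Qed.

(** The polynomial ring embeds in its fraction field, where the nonzero determinant of
    [det_krylov_neq0] makes the conjugating matrix invertible. *)
Lemma f_basis_Ker z : z \in f_basis K -> Ker_pi z.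
Proof.
move=> fz; rewrite /Ker_pi.
pose g : {rmorphism KXY -> {fraction KXY}} := @tofrac KXY.
suff /matrixP gz : map_mx g (Defs.pi z) = 0.
  by apply/matrixP=> i j; move/eqP: (gz i j); rewrite !mxE tofrac_eq0 => /eqP.
rewrite map_pi.
have gtr A : g (\tr A) = \tr (map_mx g A) by rewrite trace_map_mx.
have gM (A B : 'M_3) : map_mx g (A * B) = map_mx g A * map_mx g B by rewrite rmorphM.
have gX (A : 'M_3) n : map_mx g (A ^+ n) = map_mx g A ^+ n by rewrite rmorphXn.
have gU i : (i < 10)%N -> (g \o tnth (Uimage K)) (inord i) = g (Uimage K)`_i.
  by move=> lti; rewrite /= tnth_Uimage.
have gw (A B C D : 'M_3) : g (\tr (A * B * C * D) - \tr (B * A * D * C)) =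
    \tr (map_mx g A * map_mx g B * map_mx g C * map_mx g D)
    - \tr (map_mx g B * map_mx g A * map_mx g D * map_mx g C).
  by rewrite rmorphB /= !gtr !gM.
apply: (@eval_f_basis_cyclic _ _ _ _ _ (g (wtr K))) => //.
- by rewrite -gtr mxtrace_trless rmorph0.
- by rewrite -gtr mxtrace_trless rmorph0.
- by rewrite map_scalar_mx.
- by rewrite gU // -gX -gtr.
- by rewrite gU // -gM -gtr.
- by rewrite gU // -gX -gtr.
- by rewrite gU // -gX -gtr.
- by rewrite gU // -gX -gM -gtr.
- by rewrite gU // -gX -gM -gtr.
- by rewrite gU // -gX -gtr.
- by rewrite gU // -(gX (xm K)) -(gX (ym K)) -gM -!gM -!gtr -rmorphB.
- by rewrite -(gX (xm K)) -(gX (ym K)); apply: gw.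
rewrite unitmxE unitfE /=.
have -> : \matrix_(i, j) (map_mx g (xm K) ^+ j) i 0 =
          map_mx g (\matrix_(i, j) (xm K ^+ j) i 0) :> 'M_3.
  by apply/matrixP=> i j; rewrite !mxE -rmorphXn /= mxE.
by rewrite det_map_mx tofrac_eq0 det_krylov_neq0.
Qed.
End Kernel.

(** * Algebraic independence of the elements of U *)

(** Stated for total preorders because one application compares monomials through the leading
    monomials of their images. *)
Lemma seq_max (T : eqType) (r : rel T) (s : seq T) : total r -> transitive r -> s != [::] ->
  exists2 m, m \in s & forall x, x \in s -> r x m.
Proof.
move=> r_tot r_trans; have r_refl x : r x x by case/orP: (r_tot x x).
elim: s => // a [|b s] IH _; first by exists a; rewrite ?inE // => x; rewrite inE => /eqP->.
have [//|m ms max_m] := IH; case/orP: (r_tot a m) => am.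
  by exists m; rewrite 1?inE ?ms ?orbT // => x; rewrite inE => /predU1P[->//|/max_m].
exists a; rewrite ?mem_head // => x; rewrite inE => /predU1P[->//|/max_m xm].
exact: r_trans xm am.
Qed.

(** Distinct monomials of [p] have images with distinct leading monomials, so the largest of these
    cannot cancel. *)
Lemma alg_independent_of_mlead (K : idomainType) n k (q : n.-tuple (mpoly k K)) :
  (forall i, tnth q i != 0) ->
  injective (fun m : 'X_{1..n} => \sum_(i < n) (mlead (tnth q i) *+ m i))%MM ->
  forall p : mpoly n K, p \mPo q = 0 -> p = 0.
Proof.
move=> q0 inj_lead p /eqP; apply/contraTeq => p0.
pose c (m : 'X_{1..n}) : mpoly k K := 'X_[m] \mPo q.
have cE m : c m = \prod_(i < n) tnth q i ^+ m i by rewrite /c comp_mpolyX.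
have c0 m : c m != 0 by rewrite cE; apply/prodf_neq0 => i _; rewrite expf_neq0.
have lead_c m : mlead (c m) = (\sum_(i < n) (mlead (tnth q i) *+ m i))%MM.
  rewrite cE mlead_prod; last by move=> i _ _; rewrite expf_neq0.
  by apply: eq_bigr => i _; rewrite mleadX.
have inj_c : injective (fun m => mlead (c m)).
  by move=> m1 m2; rewrite !lead_c; apply: inj_lead.
have [|||m mp max_m] := @seq_max _ (fun m1 m2 => mlead (c m1) <= mlead (c m2))%O (msupp p).
- by move=> m1 m2; apply: le_total.
- by move=> m1 m2 m3; apply: le_trans.
- by rewrite msupp_eq0.
apply/eqP => /(congr1 (mcoeff (mlead (c m)))); rewrite mcoeff0; apply/eqP.
rewrite comp_mpolyEX raddf_sum (bigD1_seq m) //= mcoeffZ big_seq_cond big1 ?addr0.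
  by rewrite mulf_neq0 ?mleadc_eq0 // mcoeff_eq0 mp.
move=> m' /andP[m'p m'm]; rewrite mcoeffZ [X in _ * X]mcoeff_gt_mlead ?mulr0 //.
rewrite lt_neqAle (contra_neq (@inj_c _ _)) //=.
exact: max_m.
Qed.

(** * Certified leading monomials of reflected polynomials *)

Fixpoint pterms (p : Pol) : seq (Z * seq nat) :=
  match p with
  | Ring_polynom.Pc c => [:: (c, [::])]
  | Ring_polynom.Pinj j q =>
      [seq (t.1, ncons (BinPos.Pos.to_nat j) 0%N t.2) | t <- pterms q]
  | Ring_polynom.PX q j r =>
      [seq (t.1, (BinPos.Pos.to_nat j + head 0%N t.2)%N :: behead t.2) | t <- pterms q]
      ++ [seq (t.1, 0%N :: t.2) | t <- pterms r]
  end.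

Section PolTerms.
Variable R : comNzRingType.
Local Notation zval := (InitialRing.gen_phiZ 0 1 +%R *%R -%R : Z -> R).

Fixpoint eval_exps (env : seq R) (e : seq nat) : R :=
  if e is k :: e' then head 0 env ^+ k * eval_exps (behead env) e' else 1.

Lemma jumpE j (env : seq R) : BinList.jump j env = iter (BinPos.Pos.to_nat j) behead env.
Proof.
elim/BinPos.Pos.peano_ind: j env => [|j IH] env; first by [].
by rewrite BinList.jump_succ Pnat.Pos2Nat.inj_succ iterS -IH.
Qed.

Lemma eval_exps_ncons n (env : seq R) e :
  eval_exps env (ncons n 0%N e) = eval_exps (iter n behead env) e.
Proof. by elim: n env => // n IH env; rewrite iterSr -IH /= expr0 mul1r. Qed.

Lemma eval_exps_incr n (env : seq R) e :
  head 0 env ^+ (n + head 0%N e) * eval_exps (behead env) (behead e)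
  = head 0 env ^+ n * eval_exps env e.
Proof. by case: e => [|k e] /=; rewrite exprD -?mulrA // expr0 mul1r. Qed.

Lemma pow_posE (x : R) j : Ring_theory.pow_pos *%R x j = x ^+ BinPos.Pos.to_nat j.
Proof.
elim: j => [j IH|j IH|] //=; rewrite IH.
  by rewrite Pnat.Pos2Nat.inj_xI multE exprS mul2n -addnn exprD.
by rewrite Pnat.Pos2Nat.inj_xO multE mul2n -addnn exprD.
Qed.

Lemma peval_terms env p :
  peval env p = \sum_(t <- pterms p) zval t.1 * eval_exps env t.2.
Proof.
elim: p env => [c|j q IH|q IHq j r IHr] env /=.
- by rewrite big_seq1 mulr1.
- rewrite big_map /= /peval /= jumpE -/(peval _ _) IH.
  by apply: eq_bigr => t _; rewrite eval_exps_ncons.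
rewrite big_cat !big_map /peval /= -!/(peval _ _) IHq IHr mulr_suml pow_posE.
congr (_ + _); apply: eq_bigr => t _.
  by rewrite eval_exps_incr -mulrA [_ * _ ^+ _]mulrC; case: env {IHq IHr}.
by rewrite expr0 mul1r; case: env {IHq IHr}.
Qed.

End PolTerms.

Definition pad n (e : seq nat) : seq nat := mkseq (nth 0%N e) n.
(** The order of multinomials, degree first and then lexicographic, on plain lists so that it
    computes. *)
Definition mnm_lt (s t : seq nat) : bool :=
  ((sumn s :: s : seqlexi nat) < (sumn t :: t : seqlexi nat))%O.

(** Adding the coefficients of all terms with exponent [e] avoids having to prove that the exponents
    in [pterms p] are distinct. *)
Definition lead_check n (p : Pol) (e : seq nat) (c : nat) : bool :=
  BinInt.Z.eqb
    (foldr (fun t s => if pad n t.2 == e then BinInt.Z.add t.1 s else s) Z0 (pterms p))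
    (BinInt.Z.of_nat c)
  && all (fun t => (size t.2 <= n)%N && ((pad n t.2 == e) || mnm_lt (pad n t.2) e)) (pterms p).

Section LeadCheck.
Variables (K : fieldType) (n : nat).
Definition mnm_of (e : seq nat) : 'X_{1..n} := [multinom nth 0%N e i | i < n].
Definition mvars : seq (mpoly n K) := [seq 'X_i | i <- enum 'I_n].

Lemma mnm_ofE e : mnm_of e = pad n e :> seq nat.
Proof. by rewrite /pad /mkseq -val_enum_ord -map_comp. Qed.

Lemma mnm_lt_mnm_of e1 e2 :
  (mnm_of e1 < mnm_of e2)%O = mnm_lt (pad n e1) (pad n e2).
Proof. by rewrite ltEmnm /mnm_lt /mdeg !sumnE !mnm_ofE. Qed.

Lemma eval_exps_mvars e : (size e <= n)%N -> eval_exps mvars e = 'X_[mnm_of e].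
Proof.
move=> size_e; rewrite mpolyXE_id.
have -> : eval_exps mvars e = \prod_(i < size e) nth 0 mvars i ^+ nth 0%N e i.
  elim: e mvars {size_e} => [|k e IH] env /=; first by rewrite big_ord0.
  rewrite big_ord_recl /= nth0 IH; congr (_ * _); apply: eq_bigr => i _.
  by rewrite nth_behead.
rewrite (big_ord_widen n (fun i => nth 0 mvars i ^+ nth 0%N e i)) //.
rewrite [RHS](bigID (fun i : 'I_n => (i < size e)%N)) /=.
rewrite [X in _ * X]big1 ?mulr1 => [|i]; last by rewrite -leqNgt => ei; rewrite mnmE nth_default.
apply: eq_bigr => i _; rewrite mnmE (nth_map i) ?size_enum_ord ?nth_ord_enum //.
Qed.

Lemma gen_phiZ_mpolyC z : exists a : K,
  InitialRing.gen_phiZ 0 1 +%R *%R -%R z = a%:MP_[n] :> mpoly n K.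
Proof.
have nneg m : InitialRing.gen_phiZ 0 1 +%R *%R -%R (BinInt.Z.of_nat m) = (m%:R : K)%:MP_[n].
  by rewrite mpolyC_nat; exact: (@peval_const (mpoly n K) [::] m).

case: z => [|p|p]; [by exists 0; rewrite mpolyC0| |].
  by exists (BinPos.Pos.to_nat p)%:R; rewrite -nneg Znat.positive_nat_Z.
exists (- (BinPos.Pos.to_nat p)%:R); rewrite mpolyCN -nneg Znat.positive_nat_Z.
exact: (pevalN [::] (Ring_polynom.Pc (BinNums.Zpos p))).
Qed.

(** The terms with exponent [e] sum to c times that monomial, all others are strictly smaller, and c
    does not vanish in [K]. *)
Lemma lead_checkP p e c : size e = n -> c%:R != 0 :> K -> lead_check n p e c ->
  peval mvars p != 0 /\ mlead (peval mvars p) = mnm_of e.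
Proof.
move=> size_e c0 /andP[/BinInt.Z.eqb_spec coef_e small_p].
have pade : pad n e = e by rewrite -size_e /pad mkseq_nth.
rewrite peval_terms (bigID (fun t => pad n t.2 == e)) /=.
set h := \sum_(_ <- _ | _) _; set r := \sum_(_ <- _ | _) _.
have hE : h = c%:R *: 'X_[mnm_of e].
  transitivity (peval [::] (pconst c) * 'X_[mnm_of e] : mpoly n K); last first.
    by rewrite peval_const -mul_mpolyC mpolyC_nat.
  rewrite /pconst -coef_e {coef_e}/h.
  elim: (pterms p) small_p => [|t s IH] /=; first by rewrite big_nil mul0r.
  case/andP=> /andP[size_t _] small_s; rewrite big_cons IH //.
  case: eqP => // te; rewrite eval_exps_mvars //.
  have -> : mnm_of t.2 = mnm_of e by do 2 apply: val_inj; rewrite /= !mnm_ofE te pade.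
  rewrite -mulrDl; congr (_ * _).
  exact/esym/(pevalD [::] (Ring_polynom.Pc _) (Ring_polynom.Pc _)).
have lead_h : mlead h = mnm_of e by rewrite hE mleadZ // mleadXm.
have h0 : h != 0 by rewrite hE scaler_eq0 negb_or c0 -mleadc_eq0 mleadXm mcoeffX eqxx oner_neq0.
have [->|r0] := eqVneq r 0; first by rewrite addr0.
have lt_rh : (mlead r < mlead h)%O.
  rewrite lead_h; move: (mlead_supp r0); move: (mlead r) => m; rewrite /r {r0 r}.
  elim: (pterms p) small_p => [|t s IH] /=; first by rewrite big_nil msupp0.
  case/andP=> /andP[size_t]; rewrite big_cons; case: eqP => // te lt_te small_s.
  move/msuppD_le; rewrite mem_cat => /orP[|/IH->//].
  rewrite eval_exps_mvars //; have [a ->] := gen_phiZ_mpolyC t.1; rewrite mul_mpolyC.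
  by move=> /msuppZ_le; rewrite msuppX inE => /eqP->; rewrite mnm_lt_mnm_of pade.
have lead_hr := mleadDl lt_rh; split; last by rewrite lead_hr.
by rewrite -mleadc_eq0 lead_hr mcoeffD (mcoeff_gt_mlead lt_rh) addr0 mleadc_eq0.
Qed.

End LeadCheck.

(* Found by a computer search: the degree-lexicographic leading monomials of the
   elements of U at these matrices, plus the scalars given by variables 8 and 9,
   have linearly independent exponents. *)
Definition indep_x : pmat :=
  [:: [:: pvar 2; pvar 5; pvar 3]; [:: pvar 0; popp (pvar 2); pvar 4];
      [:: pvar 1; pconst 0; pconst 0]].
Definition indep_y : pmat :=
  [:: [:: pconst 0; pconst 0; pconst 1]; [:: pvar 7; pconst 0; pconst 1];
      [:: pconst 0; pvar 6; pconst 0]].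
Definition indep_xx := pmxM indep_x indep_x.
Definition indep_yy := pmxM indep_y indep_y.
Definition indep_xy := pmxM indep_x indep_y.

Definition indep_U : seq Pol :=
  [:: pmul (pconst 3) (pvar 8); pmul (pconst 3) (pvar 9);
      pmxtr indep_xx; pmxtr indep_xy; pmxtr indep_yy;
      pmxtr (pmxM indep_xx indep_x); pmxtr (pmxM indep_xx indep_y);
      pmxtr (pmxM indep_x indep_yy); pmxtr (pmxM indep_yy indep_y);
      padd (pmxtr (pmxM indep_xx indep_yy)) (popp (pmxtr (pmxM indep_xy indep_xy)))].

(* Exponents and coefficients of these leading monomials, in the order of U. *)
Definition indep_lead : seq (seq nat * nat) :=
  [:: ([:: 0; 0; 0; 0; 0; 0; 0; 0; 1; 0], 3); ([:: 0; 0; 0; 0; 0; 0; 0; 0; 0; 1], 3);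
      ([:: 1; 0; 0; 0; 0; 1; 0; 0; 0; 0], 2); ([:: 0; 0; 0; 0; 1; 0; 1; 0; 0; 0], 1);
      ([:: 0; 0; 0; 0; 0; 0; 1; 0; 0; 0], 2); ([:: 0; 1; 1; 1; 0; 0; 0; 0; 0; 0], 3);
      ([:: 1; 0; 0; 1; 0; 0; 1; 0; 0; 0], 1); ([:: 0; 0; 0; 1; 0; 0; 1; 1; 0; 0], 1);
      ([:: 0; 0; 0; 0; 0; 0; 1; 1; 0; 0], 3); ([:: 0; 0; 1; 1; 0; 0; 1; 1; 0; 0], 3)]%N.

Lemma indep_lead_ok :
  all (fun i => lead_check 10 (nth (pconst 0) indep_U i)
    (nth ([::], 0%N) indep_lead i).1 (nth ([::], 0%N) indep_lead i).2) (iota 0 10).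
Proof. by vm_compute. Qed.

(** Coordinatewise, equality of the two sums is a linear system of ten equations in the entries of
    [m1] and [m2], which [lia] solves. *)
Lemma indep_exps_inj :
  injective (fun m : 'X_{1..10} =>
    \sum_(i < 10) (mnm_of 10 (nth ([::], 0%N) indep_lead i).1 *+ m i))%MM.
Proof.
move=> m1 m2 /mnmP eq12.
have ordE (m : 'X_{1..10}) (i : 'I_10) : m i = m (inord i) by rewrite inord_val.
pose L k (m : 'X_{1..10}) := (\sum_(i < 10) nth 0 (nth ([::], 0) indep_lead i).1 k * m (inord i))%N.
have E k : (k < 10)%N -> L k m1 = L k m2.
  move=> ltk; move: (eq12 (inord k)); rewrite !mnm_sumE.
  under eq_bigr => i _ do rewrite mulmnE mnmE inordK // ordE.
  by under [RHS]eq_bigr => i _ do rewrite mulmnE mnmE inordK // ordE.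
have LE k m : L k m = foldr addn 0%N
    [seq nth 0 (nth ([::], 0) indep_lead i).1 k * m (inord i) | i <- iota 0 10]%N.
  rewrite /L -(big_mkord xpredT (fun i => nth 0 (nth ([::], 0) indep_lead i).1 k * m (inord i))%N).
  by rewrite unlock -foldr_map.
have eqs i : (i < 10)%N -> m1 (inord i) = m2 (inord i).
  have := (E 1%N isT, E 4 isT, E 5 isT, E 8 isT, E 9 isT).
  have := (E 0%N isT, E 2 isT, E 3 isT, E 6 isT, E 7 isT).
  rewrite !LE /= !(mul0n, mul1n, add0n, addn0) => -[[[[e0 e2] e3] e6] e7] [[[[e1 e4] e5] e8] e9].
  by do 10 (case: i => [|i]; [lia|]).
by apply/mnmP=> i; rewrite !(ordE _ i) eqs.
Qed.

Section AlgebraicIndependence.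
Local Arguments pmul : simpl never.
Local Arguments padd : simpl never.
Variable K : fieldType.
Hypothesis charK0 : [pchar K] =i pred0.
Local Notation KXY := {mpoly K[3 * 3 + 3 * 3]}.
Local Notation L := {mpoly K[10]}.
Local Notation env := (mvars K 10).

Lemma map_spec_trless (R : comNzRingType) (iota : {rmorphism K -> R}) (g : {rmorphism KXY -> R})
    (G : 'M[KXY]_3) A a : (forall c p, g (c *: p) = iota c * g p) ->
  map_mx g G = A + a%:M -> \tr A = 0 -> map_mx g (trless G) = A.
Proof.
move=> gZ gG trA; have /pcharf0P nK := charK0.
rewrite /trless raddfB /= map_scalar_mx /= gZ -trace_map_mx gG raddfD /= trA add0r.
rewrite mxtrace_scalar mulrnAr -mulrnAl -rmorphMn -[_ *+ 3]mulr_natr mulVf ?nK //.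
by rewrite rmorph1 mul1r addrK.
Qed.

(** A relation survives specialization to [indep_x] and [indep_y] plus scalar matrices, where the
    certified leading exponents rule it out. The scalars keep the traces of X and Y independent
    without affecting the traceless parts. *)
Lemma Uimage_alg_independent (p : KU K) : p \mPo Uimage K = 0 -> p = 0.
Proof.
have /pcharf0P nK := charK0.
pose emb : {rmorphism K -> L} := @mpolyC 10 K.
pose g : {rmorphism KXY -> L} :=
  spec emb (pmx_of env indep_x + (peval env (pvar 8))%:M)
            (pmx_of env indep_y + (peval env (pvar 9))%:M).
have trX : \tr (pmx_of env indep_x) = 0.
  by rewrite pmx_oftr (@peval_eq _ _ _ (pconst 0)) ?peval_const.
have trY : \tr (pmx_of env indep_y) = 0.
  by rewrite pmx_oftr (@peval_eq _ _ _ (pconst 0)) ?peval_const.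
have gx : map_mx g (xm K) = pmx_of env indep_x.
  by apply: map_spec_trless trX; [exact: specZ|exact: spec_genX].
have gy : map_mx g (ym K) = pmx_of env indep_y.
  by apply: map_spec_trless trY; [exact: specZ|exact: spec_genY].
have gtr A : g (\tr A) = \tr (map_mx g A) by rewrite trace_map_mx.
have gM (A B : 'M_3) : map_mx g (A * B) = map_mx g A * map_mx g B by rewrite rmorphM.
have gxx : map_mx g (xm K ^+ 2) = pmx_of env indep_xx by rewrite expr2 gM gx pmx_ofM.
have gyy : map_mx g (ym K ^+ 2) = pmx_of env indep_yy by rewrite expr2 gM gy pmx_ofM.
have gvtr : g (vtr K) = peval env (padd (pmxtr (pmxM indep_xx indep_yy))
    (popp (pmxtr (pmxM indep_xy indep_xy)))).
  rewrite /vtr; move: (xm K) (ym K) (xm K ^+ 2) (ym K ^+ 2) gxx gyy gx gy => x y A B gxx gyy gx gy.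
  rewrite rmorphB /= !gtr -(mulrA (x * y)) !gM gxx gyy gx gy.
  by rewrite -!pmx_ofM !pmx_oftr -pevalN -pevalD.
have gU i : (i < 10)%N -> g (Uimage K)`_i = peval env (nth (pconst 0) indep_U i).
  have gscal a A : \tr (pmx_of env A) = 0 -> \tr (pmx_of env A + (peval env a)%:M) =
      peval env (pmul (pconst 3) a).
    by move=> trA; rewrite raddfD /= trA add0r mxtrace_scalar pevalM peval_const mulr_natl.
  case: i => [|i]; first by move=> _; rewrite [LHS]gtr spec_genX gscal.
  case: i => [|i]; first by move=> _; rewrite [LHS]gtr spec_genY gscal.
  case: i => [|i]; first by move=> _ /=; rewrite gtr gxx pmx_oftr.
  case: i => [|i]; first by move=> _ /=; rewrite gtr gM gx gy -pmx_ofM pmx_oftr.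
  case: i => [|i]; first by move=> _ /=; rewrite gtr gyy pmx_oftr.
  case: i => [|i]; first by move=> _ /=; rewrite gtr exprSr gM gxx gx -pmx_ofM pmx_oftr.
  case: i => [|i]; first by move=> _ /=; rewrite gtr gM gxx gy -pmx_ofM pmx_oftr.
  case: i => [|i]; first by move=> _ /=; rewrite gtr gM gyy gx -pmx_ofM pmx_oftr.
  case: i => [|i]; first by move=> _ /=; rewrite gtr exprSr gM gyy gy -pmx_ofM pmx_oftr.
  by case: i => [|i].
have mem_ord10 (i : 'I_10) : val i \in iota 0 10 by rewrite mem_iota ltn_ord.
pose q := [tuple peval env (nth (pconst 0) indep_U i) | i < 10].
have qE i : tnth q i = g (tnth (Uimage K) i).
  by rewrite tnth_mktuple -gU // (tnth_nth 0).
move=> /(congr1 g); rewrite rmorph0 map_comp_Uimage => pU.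
have leads i : tnth q i != 0 /\ mlead (tnth q i) = mnm_of 10 (nth ([::], 0%N) indep_lead i).1.
  rewrite tnth_mktuple.
  have /allP/(_ _ (mem_ord10 i)) := indep_lead_ok; apply: lead_checkP.
    by case: i => -[|[|[|[|[|[|[|[|[|[|]]]]]]]]]].
  by case: i => -[|[|[|[|[|[|[|[|[|[|//]]]]]]]]]] ?; rewrite nK.
apply: (@alg_independent_of_mlead _ _ _ q).
- by move=> i; case: (leads i).
- move=> m1 m2 /=; under eq_bigr => i _ do rewrite (leads i).2.
  by under [RHS]eq_bigr => i _ do rewrite (leads i).2; apply: indep_exps_inj.
rewrite -[RHS]pU /comp_mpoly /evalU /mmap; apply: eq_bigr => m _.
rewrite /= specC; congr (_ * _); apply: mmap1_eq => i; exact: qE.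
Qed.

End AlgebraicIndependence.

(** * Freeness of the normal words *)

Section Freeness.
Variable K : fieldType.
Hypothesis charK0 : [pchar K] =i pred0.
Local Notation KXY := {mpoly K[3 * 3 + 3 * 3]}.

Definition word_mx (s : seq letter) : 'M[KXY]_3 := \prod_(l <- s) letter_image K l.
Definition wtrace s := \tr (word_mx s).

Lemma word_mx_cat s t : word_mx (s ++ t) = word_mx s * word_mx t.
Proof. by rewrite /word_mx big_cat. Qed.

Lemma wtrace_rot k s : wtrace (rot k s) = wtrace s.
Proof.
by rewrite /wtrace word_mx_cat -mulmxE mxtrace_mulC mulmxE -word_mx_cat cat_take_drop.
Qed.

(** The endomorphism exchanging the variables at (i, j) and (j, i) in both generic matrices. *)
Definition transp : {rmorphism KXY -> KXY} :=
  spec (@mpolyC (3 * 3 + 3 * 3) K : {rmorphism K -> KXY}) (genX K)^T (genY K)^T.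

Lemma map_transp_trless (A : 'M[KXY]_3) :
  map_mx transp A = A^T -> map_mx transp (trless A) = (trless A)^T.
Proof.
move=> tA; rewrite /trless raddfB /= map_scalar_mx /= specZ -trace_map_mx tA mxtrace_tr.
by rewrite mul_mpolyC raddfB /= tr_scalar_mx.
Qed.

(** Transposition reverses products. [Lw] is excluded because [transp] changes the sign of [wtr K],
    whereas a scalar matrix is its own transpose. *)
Lemma map_transp_word s : Lw \notin s -> map_mx transp (word_mx s) = (word_mx (rev s))^T.
Proof.
have tx : map_mx transp (xm K) = (xm K)^T by apply: map_transp_trless; apply: spec_genX.
have ty : map_mx transp (ym K) = (ym K)^T by apply: map_transp_trless; apply: spec_genY.
elim: s => [|l s IH]; first by rewrite /word_mx !big_nil rmorph1 trmx1.
rewrite inE negb_or => /andP[lw /IH IHs].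
rewrite rev_cons -cats1 word_mx_cat -[l :: s]cat1s word_mx_cat rmorphM /= IHs.
rewrite -mulmxE trmx_mul; congr (_ *m _).
by rewrite /word_mx !big_seq1; case: l lw.
Qed.

Lemma transp_wtrace s : Lw \notin s -> transp (wtrace s) = wtrace (rev s).
Proof. by move=> sw; rewrite /wtrace -trace_map_mx map_transp_word // mxtrace_tr. Qed.

Definition is_rotation (s t : seq letter) : bool :=
  has (fun k => s == rot k t) (iota 0 (size t).+1).

Lemma wtrace_rotation s t : is_rotation s t -> wtrace s = wtrace t.
Proof. by case/hasP=> k _ /eqP->; rewrite wtrace_rot. Qed.

Definition chiral_word := [:: Lx; Lx; Ly; Ly; Lx; Ly].

Lemma wtrE : wtr K = wtrace chiral_word - wtrace (rev chiral_word).
Proof.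
(* The reversal of xxyyxy is yxyyxx, a rotation of the word yyxxyx in [wtr]. *)
rewrite (@wtrace_rotation (rev _) [:: Ly; Ly; Lx; Lx; Ly; Lx]) //.
rewrite /wtrace /word_mx /chiral_word !big_cons !big_nil /= /wtr.
have wordE (R : nzRingType) (x y : R) :
    x * (x * (y * (y * (x * (y * 1))))) = x ^+ 2 * y ^+ 2 * x * y.
  by rewrite mulr1 !expr2 !mulrA.
by move: (xm K) (ym K) => x y; rewrite -(wordE _ x y) -(wordE _ y x).
Qed.

(** A diagonal matrix and a cyclic permutation matrix, both traceless, at which [wtr] takes the
    value 2. *)
Definition wtest_x : pmat := [:: [:: pconst 1; pconst 0; pconst 0];
  [:: pconst 0; popp (pconst 1); pconst 0]; [:: pconst 0; pconst 0; pconst 0]].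
Definition wtest_y : pmat := [:: [:: pconst 0; pconst 1; pconst 0];
  [:: pconst 0; pconst 0; pconst 1]; [:: pconst 1; pconst 0; pconst 0]].

Lemma wtr_neq0 : wtr K != 0.
Proof.
pose X : 'M[K]_3 := pmx_of [::] wtest_x; pose Y : 'M[K]_3 := pmx_of [::] wtest_y.
pose g : {rmorphism KXY -> K} := spec (idfun : {rmorphism K -> K}) X Y.
have gx : map_mx g (xm K) = X.
  apply: (@map_spec_trless _ charK0 _ _ _ _ _ 0); first exact: specZ.
    by rewrite raddf0 addr0; exact: spec_genX.
  by rewrite pmx_oftr (@peval_eq _ _ _ (pconst 0)) ?peval_const.
have gy : map_mx g (ym K) = Y.
  apply: (@map_spec_trless _ charK0 _ _ _ _ _ 0); first exact: specZ.
    by rewrite raddf0 addr0; exact: spec_genY.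
  by rewrite pmx_oftr (@peval_eq _ _ _ (pconst 0)) ?peval_const.
suff : g (wtr K) != 0 by apply: contraNneq => ->; rewrite rmorph0.
rewrite /wtr !expr2; move: (xm K) (ym K) gx gy => x y gx gy.
rewrite rmorphB /= -!trace_map_mx !rmorphM /= gx gy -!pmx_ofM !pmx_oftr -pevalN -pevalD.
have /pcharf0P nK := charK0.
by rewrite (@peval_eq _ _ _ (pconst 2)) ?peval_const ?nK //; vm_compute.
Qed.

(* The 18 normal words, each with the word it is multiplied by: by [normal_pairs_dual],
   the odd traces form a triangular matrix. *)
Definition normal_pairs : seq (seq letter * seq letter) :=
  let x := Lx in let y := Ly in
  [:: ([:: y; y; x; y; x; x], [::]);
      ([:: y; x; y; x; x], [:: y]); ([:: y; y; x; y; x], [:: x]);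
      ([:: x; y; x; x], [:: y; y]); ([:: y; y; x; y], [:: x; x]);
      ([:: y; x; y; x], [:: x; y]); ([:: y; y; x; x], [:: y; x]);
      ([:: y; x; x], [:: y; x; y]); ([:: x; y; x], [:: y; y; x]);
      ([:: y; y; x], [:: x; y; x]); ([:: y; x; y], [:: y; x; x]);
      ([:: x; x], [:: y; y; x; y]); ([:: y; y], [:: x; y; x; x]);
      ([:: x; y], [:: y; x; y; x]); ([:: y; x], [:: y; y; x; x]);
      ([:: x], [:: y; y; x; y; x]); ([:: y], [:: y; x; y; x; x]);
      ([::], [:: y; y; x; y; x; x])].

Definition normal_words := unzip1 normal_pairs.

Definition achiral s := is_rotation (rev s) s.
(** Not the mere negation of [achiral]: only the two cyclic classes whose odd trace is [wtr K] up to
    sign. *)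
Definition chiral s := is_rotation s chiral_word || is_rotation s (rev chiral_word).

Definition no_w : pred (seq letter) := fun s => Lw \notin s.

Lemma normal_pairs_dual :
  [&& pairwise (fun p q => achiral (q.1 ++ p.2)) normal_pairs,
      all (fun p => chiral (p.1 ++ p.2)) normal_pairs
    & all (fun p => no_w p.1 && no_w p.2) normal_pairs].
Proof. by []. Qed.

Definition wtrace_odd s := wtrace s - wtrace (rev s).

Lemma wtrace_odd_achiral s : achiral s -> wtrace_odd s = 0.
Proof. by move=> /wtrace_rotation; rewrite /wtrace_odd => ->; rewrite subrr. Qed.

Lemma wtrace_odd_rotation s t : is_rotation s t -> wtrace_odd s = wtrace_odd t.
Proof.
by case/hasP=> k _ /eqP->; rewrite /wtrace_odd rev_rot wtrace_rot /rotr wtrace_rot.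
Qed.

Lemma wtrace_odd_chiral s : chiral s -> wtrace_odd s != 0.
Proof.
case/orP=> /wtrace_odd_rotation->; rewrite /wtrace_odd; first by rewrite -wtrE wtr_neq0.
by rewrite revK -oppr_eq0 opprB -wtrE wtr_neq0.
Qed.

(** The two dropped entries are traces of [genX] and [genY] themselves, not of words in their
    traceless parts, and are treated separately. *)
Lemma Uimage_wtrace : let x := Lx in let y := Ly in
  drop 2 (Uimage K) = [:: wtrace [:: x; x]; wtrace [:: x; y]; wtrace [:: y; y];
    wtrace [:: x; x; x]; wtrace [:: x; x; y]; wtrace [:: x; y; y]; wtrace [:: y; y; y];
    wtrace [:: x; x; y; y] - wtrace [:: x; y; x; y]].
Proof.
rewrite /wtrace /word_mx !big_cons !big_nil /= /vtr; move: (xm K) (ym K) => x y.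
have e2 (z : 'M[KXY]_3) : z * (z * 1) = z ^+ 2 by rewrite mulr1.
have e3 (z : 'M[KXY]_3) : z * z ^+ 2 = z ^+ 3 by rewrite -exprS.
by rewrite !e2 !e3 !mulr1 !mulrA.
Qed.

(** Every word whose trace occurs in [Uimage_wtrace] is a rotation of its reversal, and tr(X), tr(Y)
    are fixed by transposition. *)
Lemma transp_comp_Uimage (p : KU K) : transp (p \mPo Uimage K) = p \mPo Uimage K.
Proof.
have tw s : no_w s -> achiral s -> transp (wtrace s) = wtrace s.
  by move=> sw /wtrace_rotation rs; rewrite transp_wtrace.
rewrite map_comp_Uimage /comp_mpoly /evalU /mmap; apply: eq_bigr => m _.
rewrite /= specC; congr (_ * _); apply: mmap1_eq => i /=; rewrite (tnth_nth 0).
have trG (G : 'M[KXY]_3) : map_mx transp G = G^T -> transp (\tr G) = \tr G.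
  by move=> tG; rewrite -trace_map_mx tG mxtrace_tr.
case: i => -[|i] lti /=; first by rewrite trG ?spec_genX.
case: i lti => [|i] lti /=; first by rewrite trG ?spec_genY.
have /(congr1 (fun r => nth 0 r i)) /= -> := Uimage_wtrace.
do 8 (case: i lti => [|i] lti /=; first by rewrite ?rmorphB /= !tw).
by [].
Qed.

(** Elimination in a triangular system: tested against the partner of the first pair, all later
    terms vanish and the diagonal one is a nonzero multiple of P, in a domain. The first term then
    drops out of the remaining equations. *)
Lemma dual_elimination (P : seq letter -> KXY) (l : seq (seq letter * seq letter)) :
  pairwise (fun p q => achiral (q.1 ++ p.2)) l ->
  all (fun p => chiral (p.1 ++ p.2)) l ->
  (forall p, p \in l -> \sum_(q <- l) P q.1 * wtrace_odd (q.1 ++ p.2) = 0) ->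
  forall p, p \in l -> P p.1 = 0.
Proof.
elim: l => // p l IH /=; case/andP=> /allP pl pw_l /andP[chi_p chi_l] sum0.
have P0 : P p.1 = 0.
  have := sum0 p (mem_head _ _); rewrite big_cons big_seq big1 => [|q lq]; last first.
    by rewrite wtrace_odd_achiral ?mulr0 ?pl.
  by move/eqP; rewrite addr0 mulf_eq0 (negPf (wtrace_odd_chiral chi_p)) orbF => /eqP.
move=> q; rewrite inE => /predU1P[->//|]; apply: IH => // r lr.
by have := sum0 r; rewrite inE lr orbT big_cons P0 mul0r add0r; apply.
Qed.

Lemma normal_words_free (q : seq letter -> KU K) :
  \sum_(s <- normal_words) (q s \mPo Uimage K) *: word_mx s = 0 ->
  forall s, s \in normal_words -> q s = 0.
Proof.
move=> sum0 s /mapP[p lp ->]; apply: (Uimage_alg_independent charK0).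
pose P s := q s \mPo Uimage K.
have /and3P[pw chi /allP nw] := normal_pairs_dual.
apply: (@dual_elimination P normal_pairs) => // r lr.
have sum1 : \sum_(s <- normal_words) P s * wtrace (s ++ r.2) = 0.
  have := congr1 (fun A => \tr (A * word_mx r.2)) sum0.
  rewrite mul0r raddf0 mulr_suml raddf_sum => E; rewrite -[RHS]E; apply: eq_bigr => t _ /=.
  by rewrite -scalerAl mxtraceZ /wtrace word_mx_cat.
(* Transposition fixes the coefficients, so subtracting the transposed relation leaves the odd
   traces. *)
have := congr1 transp sum1; rewrite rmorph0 rmorph_sum => sum2.
transitivity (\sum_(s <- normal_words) P s * wtrace_odd (s ++ r.2)).
  by rewrite /normal_words big_map.
have := congr2 (fun a b => a - b) sum1 sum2; rewrite /= subr0 -sumrB => E; rewrite -[RHS]E.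
apply: eq_big_seq => t.
case/mapP=> u /nw/andP[u1 _] ->; have /andP[_ r2] := nw _ lr.
rewrite rmorphM /= transp_comp_Uimage transp_wtrace -?mulrBr //.
by rewrite mem_cat negb_or; apply/andP.
Qed.

End Freeness.

(** * The order on words *)

Section WordOrder.

Definition wdeg (s : seq letter) : nat := sumn (map letter_deg s).

(** A structural recursion on lists, which computes on concrete words; [word_ltE] ties it to
    [word_lt]. *)
Fixpoint wlex (s t : seq letter) : bool :=
  match s, t with
  | _, [::] => false
  | [::], _ :: _ => true
  | a :: s', b :: t' =>
      (letter_rank a < letter_rank b)%N || (a == b) && wlex s' t'
  end.

Definition wlt s t := (wdeg s < wdeg t)%N || (wdeg s == wdeg t) && wlex s t.

Lemma letter_deg_gt0 l : (0 < letter_deg l)%N. Proof. by case: l. Qed.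

Lemma word_ltE (f g : word) : word_lt f g = wlt f g.
Proof.
have degE (h : word) : word_deg h = wdeg h by rewrite /word_deg /wdeg sumnE big_map.
rewrite /word_lt /wlt !degE; congr (_ || _ && _).
elim: (fmonom_val f) (fmonom_val g) => [|a s IH] [|b t] //=.
rewrite ltxi_cons !leEnat -IH -(inj_eq (can_inj letter_rankK)).
by case: (ltngtP (letter_rank a) (letter_rank b)).
Qed.

Lemma wlex_irr s : wlex s s = false.
Proof. by elim: s => //= a s ->; rewrite ltnn andbF. Qed.

Lemma wlex_trans t s u : wlex s t -> wlex t u -> wlex s u.
Proof.
elim: t s u => [|b t IH] [|a s] [|c u] //=.
case/orP=> [ab|/andP[/eqP-> st]]; case/orP=> [bc|/andP[/eqP<- tu]].
- by rewrite (ltn_trans ab bc).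
- by rewrite ab.
- by rewrite bc.
- by rewrite eqxx (IH _ _ st tu) orbT.
Qed.

Lemma wlex_total s t : [|| s == t, wlex s t | wlex t s].
Proof.
elim: s t => [|a s IH] [|b t] //=; rewrite eqseq_cons [b == a]eq_sym.
have [->|ab] := eqVneq a b; first by rewrite ltnn ?eqxx /= IH.
have : letter_rank a != letter_rank b by rewrite (inj_eq (can_inj letter_rankK)).
by case: ltngtP; rewrite ?orbT.
Qed.

Lemma wlt_irr s : wlt s s = false.
Proof. by rewrite /wlt ltnn wlex_irr andbF. Qed.

Lemma wlt_trans t s u : wlt s t -> wlt t u -> wlt s u.
Proof.
rewrite /wlt => /orP[st|/andP[/eqP-> st]] /orP[tu|/andP[/eqP<- tu]].
- by rewrite (ltn_trans st tu).
- by rewrite st.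
- by rewrite tu.
- by rewrite eqxx (wlex_trans st tu) orbT.
Qed.

Lemma wlt_total s t : [|| s == t, wlt s t | wlt t s].
Proof.
rewrite /wlt; case: (ltngtP (wdeg s) (wdeg t)) => //=; rewrite ?orbT // => _.
exact: wlex_total.
Qed.

Lemma wdeg_cat s t : wdeg (s ++ t) = (wdeg s + wdeg t)%N.
Proof. by rewrite /wdeg map_cat sumn_cat. Qed.

(* Two words of equal degree are never proper prefixes of each other. *)
Lemma wlex_catr s t h : wdeg s = wdeg t -> wlex s t -> wlex (s ++ h) (t ++ h).
Proof.
elim: s t => [|a s IH] [|b t] //=.
  by move=> /eqP; rewrite /wdeg /= eq_sym addn_eq0 eqn0Ngt letter_deg_gt0.
move=> deg_st /orP[->//|/andP[/eqP ab st]]; rewrite ab eqxx IH ?orbT //.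
by move: deg_st; rewrite /wdeg /= ab => /addnI.
Qed.

Lemma wlex_catl s t h : wlex (h ++ s) (h ++ t) = wlex s t.
Proof. by elim: h => //= a h ->; rewrite ltnn eqxx. Qed.

Lemma wlt_cat h1 h2 s t : wlt s t -> wlt (h1 ++ s ++ h2) (h1 ++ t ++ h2).
Proof.
rewrite /wlt !wdeg_cat ltn_add2l ltn_add2r eqn_add2l eqn_add2r wlex_catl.
by case: ltngtP => //= deg_st; apply: wlex_catr.
Qed.

(** Base 4 expansion on n digits, first letter most significant: digits 1 to 3 are letters and 0 is
    padding, so a proper prefix gets a smaller code. *)
Fixpoint wcode n (s : seq letter) : nat :=
  if n is n'.+1 then
    if s is a :: s' then ((letter_rank a).+1 * 4 ^ n' + wcode n' s')%N else 0%N
  else 0%N.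

Lemma wcode_lt n s : (wcode n s < 4 ^ n)%N.
Proof.
elim: n s => [|n IH] [|a s] //=; first by rewrite expn_gt0.
have : ((letter_rank a).+1 <= 3)%N by case: a.
by have := IH s; rewrite expnS; nia.
Qed.

Lemma wcode_wlex n s t : (size t <= n)%N -> wlex s t -> (wcode n s < wcode n t)%N.
Proof.
elim: n s t => [|n IH] [|a s] [|b t] //= size_t.
  by rewrite addn_gt0 muln_gt0 expn_gt0.
case/orP=> [ab|/andP[/eqP-> st]]; last by rewrite ltn_add2l IH.
by have := wcode_lt n s; nia.
Qed.

Lemma size_wdeg s : (size s <= wdeg s)%N.
Proof.
elim: s => //= a s IH; rewrite /wdeg /= -add1n leq_add //; exact: letter_deg_gt0.
Qed.

(* Words of degree d have length at most d and are coded in base 4 below 4^d. *)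
Definition wmeasure s := (4 ^ wdeg s + wcode (wdeg s) s)%N.

(** In degree d the measure lies in [4^d, 2 4^d), so a larger degree always wins; in equal degree
    the code decides. This embeds the order in the natural numbers and makes it well founded. *)
Lemma wmeasure_wlt s t : wlt s t -> (wmeasure s < wmeasure t)%N.
Proof.
rewrite /wlt /wmeasure => /orP[deg_st|/andP[/eqP-> st]].
  have := wcode_lt (wdeg s) s; have : (4 ^ (wdeg s).+1 <= 4 ^ wdeg t)%N by rewrite leq_exp2l.
  by rewrite expnS; lia.
by rewrite ltn_add2l wcode_wlex // size_wdeg.
Qed.

Lemma wlt_ind (P : seq letter -> Prop) :
  (forall s, (forall t, wlt t s -> P t) -> P s) -> forall s, P s.
Proof.
move=> IH s; have [n] := ubnP (wmeasure s).
elim: n s => // n IHn s size_s; apply: IH => t /wmeasure_wlt ts; apply: IHn.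
exact: leq_trans ts size_s.
Qed.

End WordOrder.

(** * Reduction to normal words *)

Section Reduction.
Variable K : fieldType.
Hypothesis charK0 : [pchar K] =i pred0.
Local Notation A := (freeKU K).

Definition cword (s : seq letter) : A := monalg.mkmalgU (monalg.FMonom s) 1.

Lemma cword_nil : cword [::] = 1.
Proof. by rewrite /cword -fmoneE. Qed.

Lemma cword_lvar l : lvar K l = cword [:: l].
Proof. by rewrite /lvar /cword fmuE. Qed.

Lemma cwordM s t : cword s * cword t = cword (s ++ t).
Proof. by rewrite /cword malgM_def fgmulUU mulr1; congr (monalg.mkmalgU _ 1); apply: fmmulE. Qed.

Lemma mcoeff_cword s f : monalg.mcoeff f (cword s) = (monalg.FMonom s == f)%:R :> KU K.
Proof. exact: mcoeffU1. Qed.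

Lemma malg_cword (z : A) :
  z = \sum_(f <- finmap.enum_fset (monalg.msupp z)) monalg.mcoeff f z *: cword f.
Proof.
rewrite {1}[z]monalgE; apply: eq_bigr => f _; apply/malgP => g.
by rewrite monalg.mcoeffZ mcoeff_cword fmK monalg.mcoeffU mulr_natr.
Qed.

Lemma pi_cword s : Defs.pi (cword s) = word_mx K s.
Proof. by rewrite /Defs.pi /cword monalg.mmapU /= rmorph1 mul1r. Qed.

Definition below (s : seq letter) (z : A) :=
  forall f, monalg.mcoeff f z != 0 -> wlt (fmonom_val f) s.

Lemma belowD s z1 z2 : below s z1 -> below s z2 -> below s (z1 + z2).
Proof.
move=> z1s z2s f; rewrite monalg.mcoeffD; have [->|/z1s//] := eqVneq (monalg.mcoeff f z1) 0.
by rewrite add0r => /z2s.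
Qed.

Lemma belowN s z : below s z -> below s (- z).
Proof. by move=> zs f; rewrite monalg.mcoeffN oppr_eq0 => /zs. Qed.

Lemma belowZ s p z : below s z -> below s (p *: z).
Proof.
move=> zs f; rewrite monalg.mcoeffZ; have [->|/zs//] := eqVneq (monalg.mcoeff f z) 0.
by rewrite mulr0 eqxx.
Qed.

Lemma below_nat s n z : below s z -> below s (n%:R * z).
Proof. by rewrite mulr_natl -scaler_nat; apply: belowZ. Qed.

Lemma below_cword s t : wlt t s -> below s (cword t).
Proof. by move=> ts f; rewrite mcoeff_cword; have [<-|] := eqVneq _ f; rewrite ?eqxx. Qed.

(** The top coefficient is a nonzero constant of [K] rather than any nonzero element of K[U]: being
    invertible, it lets [b] rewrite the word [s]. *)
Definition leads (b : A) (s : seq letter) :=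
  exists2 c : K, c != 0 & below s (b - c%:MP *: cword s).

Lemma leads_is_leading leU b s : leads b s -> is_leading leU b (0%MM, monalg.FMonom s).
Proof.
case=> c c0 bs; rewrite /is_leading /monomial_coeff /=.
have coef_b f : monalg.mcoeff f b =
    c%:MP * (monalg.FMonom s == f)%:R + monalg.mcoeff f (b - c%:MP *: cword s).
  by rewrite monalg.mcoeffB monalg.mcoeffZ mcoeff_cword addrC subrK.
have bs0 : monalg.mcoeff (monalg.FMonom s) (b - c%:MP *: cword s) = 0.
  by apply/eqP; apply: contraT => /bs; rewrite wlt_irr.
split; first by rewrite coef_b bs0 eqxx addr0 mulr1 mcoeffC eqxx mulr1.
move=> [a f] /=; have [<-|fs] := eqVneq (monalg.FMonom s) f.
  rewrite coef_b bs0 eqxx addr0 mulr1 mcoeffC; have [<-|] := eqVneq 0%MM a; first by left.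
  by rewrite mulr0 eqxx.
rewrite coef_b (negPf fs) mulr0 add0r => bf; right.
rewrite /monomial_lt /= word_ltE bs //; apply: contraNneq bf => ->.
by rewrite mcoeff0.
Qed.

End Reduction.

(** * Leading words of the generators *)

Section Leads.
Variable K : fieldType.
Hypothesis charK0 : [pchar K] =i pred0.
Local Notation A := (freeKU K).

Definition mono (z : A) s := z = cword K s.

Lemma monoM z1 z2 s1 s2 : mono z1 s1 -> mono z2 s2 -> mono (z1 * z2) (s1 ++ s2).
Proof. by rewrite /mono => -> ->; rewrite cwordM. Qed.

Lemma monoX z s n : mono z s -> mono (z ^+ n) (iter n (cat s) [::]).
Proof.
move=> zs; elim: n => [|n IH]; first by rewrite /mono expr0 cword_nil.
by rewrite exprS; apply: monoM.
Qed.

Lemma mono1 : mono 1 [::].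
Proof. by rewrite /mono cword_nil. Qed.

Lemma mono_lvar l : mono (lvar K l) [:: l].
Proof. exact: cword_lvar. Qed.

Lemma below_mono s z t : mono z t -> wlt t s -> below s z.
Proof. by move=> ->; apply: below_cword. Qed.

Lemma leads_mono (z : A) s t : mono z t -> t = s -> leads z s.
Proof.
move=> -> ->; exists 1; first exact: oner_neq0.
by rewrite mpolyC1 scale1r subrr => f; rewrite monalg.mcoeff0 eqxx.
Qed.

Lemma leads_nat n (z : A) s : leads z s -> leads (n.+1%:R * z) s.
Proof.
case=> c c0 zs; have n0 : n.+1%:R != 0 :> K by have /pcharf0P -> := charK0.
exists (n.+1%:R * c); first by rewrite mulf_neq0.
have -> : n.+1%:R * z - (n.+1%:R * c)%:MP *: cword K s = n.+1%:R * (z - c%:MP *: cword K s).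
  by rewrite mulrBr mpolyCM mpolyC_nat -scalerA scaler_nat [n.+1%:R * (_ *: _)]mulr_natl.
exact: below_nat.
Qed.

Lemma leadsD (b t : A) s : leads b s -> below s t -> leads (b + t) s.
Proof. by case=> c c0 bs ts; exists c => //; rewrite addrAC; apply: belowD. Qed.

Lemma leadsDl (b t : A) s : leads b s -> below s t -> leads (t + b) s.
Proof. by rewrite addrC; apply: leadsD. Qed.

Lemma leadsN (b : A) s : leads b s -> leads (- b) s.
Proof.
case=> c c0 bs; exists (- c); first by rewrite oppr_eq0.
have -> : - b - (- c)%:MP *: cword K s = - (b - c%:MP *: cword K s).
  by rewrite mpolyCN scaleNr opprK opprB addrC.
exact: belowN.
Qed.

End Leads.

Ltac mono_step :=
  lazymatch goal with
  | |- mono (_ * _) _ => eapply monoM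
  | |- mono (_ ^+ _) _ => eapply monoX
  | |- mono 1 _ => eapply mono1
  | |- mono _ _ => eapply mono_lvar
  end.
Ltac below_step :=
  lazymatch goal with
  | |- below _ (_ + _) => apply belowD
  | |- below _ (- _) => apply belowN
  | |- below _ (_ *: _) => apply belowZ
  | |- below _ (_%:R * _) => apply below_nat
  | |- below _ _ => eapply below_mono; [repeat mono_step | by vm_compute]
  end.
Ltac leads_tac :=
  lazymatch goal with
  | |- leads (_ + _) _ => eapply leadsD; [leads_tac | solve [repeat below_step]]
  | |- leads (_%:R * _) _ => apply: leads_nat => //; leads_tac
  | |- leads _ _ => eapply leads_mono; [repeat mono_step | reflexivity]
  end.

Section BasisLeads.
Variable K : fieldType.
Hypothesis charK0 : [pchar K] =i pred0.

Lemma leads_f6 : leads (f6 K) [:: Lx; Lx; Lx].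
Proof. rewrite /f6; leads_tac. Qed.

Lemma leads_f7 : leads (f7 K) [:: Lx; Lx; Ly].
Proof. rewrite /f7; leads_tac. Qed.

Lemma leads_f8 : leads (f8 K) [:: Lx; Ly; Ly].
Proof. rewrite /f8; leads_tac. Qed.

Lemma leads_f9 : leads (f9 K) [:: Ly; Ly; Ly].
Proof. rewrite /f9; leads_tac. Qed.

Lemma leads_f10 : leads (f10 K) [:: Lx; Ly; Lx; Ly].
Proof. rewrite /f10; leads_tac. Qed.

(* As [w33] has degree 6, it exceeds the words of length 6 in [x1] and [y1]. *)
Lemma leads_f11 : leads (f11 K) [:: Lw].
Proof.
rewrite /f11; apply: leadsDl; last by repeat below_step.
apply: (leads_nat charK0 1); apply: leadsDl; last by repeat below_step.
apply: leadsN; leads_tac.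
Qed.

End BasisLeads.

(** * Normal forms modulo the kernel *)

Section NormalForms.
Variable K : fieldType.
Hypothesis charK0 : [pchar K] =i pred0.
Local Notation A := (freeKU K).
Local Notation cword := (cword K).
Local Notation pi := (@Defs.pi K).

Definition leading_words : seq (seq letter) :=
  [:: [:: Lx; Lx; Lx]; [:: Lx; Lx; Ly]; [:: Lx; Ly; Ly]; [:: Ly; Ly; Ly];
      [:: Lx; Ly; Lx; Ly]; [:: Lw]].

Lemma leading_wordsP m : m \in leading_words -> exists2 b, b \in f_basis K & leads b m.
Proof.
have fb i : (i < 11)%N -> (f_basis K)`_i \in f_basis K by move=> lti; apply: mem_nth.
rewrite !inE => /or4P[/eqP->|/eqP->|/eqP->|/or3P[/eqP->|/eqP->|/eqP->]].
- by exists (f6 K); [exact: (fb 5) | exact: leads_f6].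
- by exists (f7 K); [exact: (fb 6) | exact: leads_f7].
- by exists (f8 K); [exact: (fb 7) | exact: leads_f8].
- by exists (f9 K); [exact: (fb 8) | exact: leads_f9].
- by exists (f10 K); [exact: (fb 9) | exact: leads_f10].
- by exists (f11 K); [exact: (fb 10) | exact: leads_f11].
Qed.

Definition reducible s := has (fun m => infix m s) leading_words.

Lemma Ker_piD (z1 z2 : A) : Ker_pi z1 -> Ker_pi z2 -> Ker_pi (z1 + z2).
Proof. by rewrite /Ker_pi => k1 k2; rewrite rmorphD /= k1 k2 addr0. Qed.

Lemma Ker_piZ p (z : A) : Ker_pi z -> Ker_pi (p *: z).
Proof. by rewrite /Ker_pi => k; rewrite piZ k scaler0. Qed.

(** Induction on the last letter: a reducible prefix stays an infix, and the one-letter extensions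
    of the 18 normal words form a finite check. *)
Lemma reducible_or_normal s : reducible s \/ s \in normal_words.
Proof.
have step : all (fun s => all (fun l => reducible (rcons s l) || (rcons s l \in normal_words))
  [:: Lx; Ly; Lw]) normal_words by vm_compute.
elim/last_ind: s => [|s l [/hasP[m lm ms]|ns]]; first by right.
  by left; apply/hasP; exists m => //; rewrite -cats1 infix_catr.
have /allP/(_ s ns)/allP/(_ l) := step.
by case: l => /(_ isT)/orP[]; [left|right|left|right|left|right].
Qed.

Definition nform (q : seq letter -> KU K) : A := \sum_(s <- normal_words) q s *: cword s.

(** [P] bounds the words in the normal form, recording that reduction does not raise the order. *)
Definition reduces (P : pred (seq letter)) (z : A) :=
  exists2 q, Ker_pi (z - nform q) & forall s, q s != 0 -> P s.

Lemma reduces_sub (P Q : pred (seq letter)) z : subpred P Q -> reduces P z -> reduces Q z.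
Proof. by move=> PQ [q kz qP]; exists q => // s /qP/PQ. Qed.

Lemma reduces_ker P z1 z2 : Ker_pi (z1 - z2) -> reduces P z2 -> reduces P z1.
Proof.
move=> k12 [q k2 qP]; exists q; last exact: qP.
by rewrite -(subrK z2 z1) -addrA; exact: Ker_piD k12 k2.
Qed.

Lemma reduces0 P : reduces P 0.
Proof.
exists (fun=> 0) => [|s]; last by rewrite eqxx.
by rewrite /Ker_pi /nform big1 ?subr0 ?rmorph0 // => s _; rewrite scale0r.
Qed.

Lemma reducesD P z1 z2 : reduces P z1 -> reduces P z2 -> reduces P (z1 + z2).
Proof.
move=> [q1 k1 q1P] [q2 k2 q2P]; exists (fun s => q1 s + q2 s) => [|s].
  have -> : nform (fun s => q1 s + q2 s) = nform q1 + nform q2.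
    by rewrite /nform -big_split; apply: eq_bigr => s _; rewrite scalerDl.
  by rewrite opprD addrACA; exact: Ker_piD k1 k2.
by have [->|/q1P//] := eqVneq (q1 s) 0; rewrite add0r => /q2P.
Qed.

Lemma reducesZ P p z : reduces P z -> reduces P (p *: z).
Proof.
move=> [q k qP]; exists (fun s => p * q s) => [|s].
  have -> : nform (fun s => p * q s) = p *: nform q.
    by rewrite /nform scaler_sumr; apply: eq_bigr => s _; rewrite scalerA.
  by rewrite -scalerBr; exact: Ker_piZ k.
by have [->|/qP//] := eqVneq (q s) 0; rewrite mulr0 eqxx.
Qed.

(** Elements of K[U] are central: [p] is turned into an element of the free algebra supported on the
    empty word, which commutes with every word. *)
Lemma cword_scaler s p (z : A) : cword s * (p *: z) = p *: (cword s * z).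
Proof.
pose c : A := monalg.mkmalgU (monalg.one : word) p.
have comm_c : cword s * c = c * cword s.
  by rewrite !malgM_def !fgmulUU mulr1 mul1r mulm1 mul1m.
apply: etrans (congr1 (fun t => cword s * t) (esym (mul_malgC p z))) _.
apply: etrans (mul_malgC p (cword s * z)).
by rewrite mulrA [RHS]mulrA; exact: (congr1 (fun t => t * z) comm_c).
Qed.

Lemma reduces_mul P h1 h2 (z : A) :
  (forall f, monalg.mcoeff f z != 0 -> reduces P (cword (h1 ++ fmonom_val f ++ h2))) ->
  reduces P (cword h1 * z * cword h2).
Proof.
move=> red; rewrite {1}[z]malg_cword mulr_sumr mulr_suml.
elim/big_ind: _ => [||f _]; [exact: reduces0|exact: reducesD|].
rewrite cword_scaler -scalerAl !cwordM -catA.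
have [->|/red] := eqVneq (monalg.mcoeff f z) 0; last exact: reducesZ.
by rewrite scale0r; apply: reduces0.
Qed.

Lemma nform_cword p s : s \in normal_words ->
  nform (fun t => if t == s then p else 0) = p *: cword s.
Proof.
move=> ns; rewrite /nform (bigD1_seq s) //= eqxx big1 ?addr0 // => t /negPf->.
by rewrite scale0r.
Qed.

(** Well-founded induction. A reducible word is h1 m h2 with m leading a generator; replacing m by
    lower words gives smaller words, as the order is compatible with concatenation. *)
Lemma reduces_word s : reduces (fun t => (t == s) || wlt t s) (cword s).
Proof.
elim/wlt_ind: s => s IH.
have [/hasP[m /leading_wordsP[b bf [c c0 bm]]]|ns] := reducible_or_normal s.
  move/infixP=> [h1 [h2 defs]].
  (* [r] is congruent to [cword m] modulo the kernel, and the normalization by c^-1 cancels the word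
     m in it. *)
  pose r := cword m - c^-1%:MP *: b.
  have rm : below m r.
    have -> : r = - (c^-1%:MP *: (b - c%:MP *: cword m)).
      by rewrite scalerBr scalerA -mpolyCM mulVf // mpolyC1 scale1r opprB.
    exact/belowN/belowZ.
  apply: (@reduces_ker _ _ (cword h1 * r * cword h2)).
    have -> : cword s - cword h1 * r * cword h2 = cword h1 * (c^-1%:MP *: b) * cword h2.
      by rewrite defs -!cwordM mulrA -mulrBl -mulrBr /r opprB addrC subrK.
    by apply/Ker_piP/Ker_piZ/f_basis_Ker.
  apply: reduces_mul => f /rm/(wlt_cat h1 h2); rewrite -defs => fs.
  apply: reduces_sub (IH _ fs) => t /predU1P[->|ts]; first by rewrite fs orbT.
  by rewrite (wlt_trans ts fs) orbT.
exists (fun t => if t == s then 1 else 0) => [|t]; last by case: ifP => // _; rewrite eqxx.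
by rewrite nform_cword // scale1r /Ker_pi subrr rmorph0.
Qed.

Lemma reduces_below s z : below s z -> reduces (fun t => wlt t s) z.
Proof.
move=> zs; rewrite -[z]mulr1 -[z]mul1r -(cword_nil K).
apply: reduces_mul => f /zs fs; rewrite cats0.
apply: reduces_sub (reduces_word _) => t /predU1P[->//|ts]; exact: wlt_trans ts fs.
Qed.

Lemma nform_free q s : Ker_pi (nform q) -> s \in normal_words -> q s = 0.
Proof.
move=> kq; apply: (normal_words_free charK0); rewrite -[RHS]kq rmorph_sum.
by apply: eq_bigr => t _; rewrite /= piZ pi_cword.
Qed.

(** If g were normal, the rest of z would reduce to words strictly below g, so the normal form of z
    would keep the nonzero coefficient of g, contradicting freeness. *)
Lemma Ker_pi_leading_reducible (z : A) (g : word) : Ker_pi z ->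
  monalg.mcoeff g z != 0 ->
  (forall f, monalg.mcoeff f z != 0 -> f = g \/ wlt (fmonom_val f) g) ->
  reducible g.
Proof.
move=> kz zg ltg; have [//|ng] := reducible_or_normal g.
pose p := monalg.mcoeff g z.
have [f|q kq qg] := @reduces_below g (z - p *: cword g).
  rewrite monalg.mcoeffB monalg.mcoeffZ mcoeff_cword fmK.
  have [<-|fg] := eqVneq g f; first by rewrite mulr1 subrr eqxx.
  by rewrite mulr0 subr0 => /ltg[/eqP|//]; rewrite eq_sym (negPf fg).
pose q' t := (if t == g :> seq letter then p else 0) + q t.
have q'E : nform q' = p *: cword g + nform q.
  by rewrite -nform_cword // /nform -big_split; apply: eq_bigr => t _; rewrite scalerDl.
have /nform_free/(_ ng) : Ker_pi (nform q').
  have -> : nform q' = z + -1 *: (z - p *: cword g - nform q).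
    by rewrite q'E scaleN1r !opprB [RHS]addrCA [z + _]addrC subrK addrC.
  exact: Ker_piD kz (Ker_piZ _ kq).
rewrite /q' eqxx; have -> : q g = 0 by apply/eqP; apply: contraT => /qg; rewrite wlt_irr.
by rewrite addr0 => /eqP; rewrite (negPf zg).
Qed.

End NormalForms.

(** * Leading monomials and the Groebner property *)

Lemma leading_exists (K : fieldType) (leU : rel Umon) (z : freeKU K) :
  admissible_order leU -> z != 0 -> exists n, is_leading leU z n.
Proof.
case=> leU_total leU_trans _ _ _ z0.
have memE (h : word) : (h \in finmap.enum_fset (monalg.msupp z)) = (monalg.mcoeff h z != 0).
  by rewrite monalg.mcoeff_neq0.
pose le_word (f g : word) := (f == g) || word_lt f g.
have [|||g zg max_g] := @seq_max _ le_word (finmap.enum_fset (monalg.msupp z)).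
- move=> f g; rewrite /le_word !word_ltE [g == f]eq_sym fmP.
  by case/or3P: (wlt_total f g) => ->; rewrite ?orbT.
- move=> g f h; rewrite /le_word !word_ltE => /predU1P[->//|fg] /predU1P[<-|gh].
    by rewrite fg orbT.
  by rewrite (wlt_trans fg gh) orbT.
- by apply: contraNneq z0 => z_nil; rewrite [z]malg_cword z_nil big_nil.
(* Once the largest word is fixed, the largest monomial of its coefficient is taken. *)
have [|||a za max_a] := @seq_max _ leU (mpoly.msupp (monalg.mcoeff g z)); [by []|by []| |].
  by rewrite msupp_eq0 -memE.
exists (a, g); rewrite /is_leading /monomial_coeff /=; split; first by rewrite -mcoeff_msupp.
move=> [b f] /=; rewrite -mcoeff_msupp => zf.
have : f \in finmap.enum_fset (monalg.msupp z).
  by rewrite memE; apply: contraTneq zf => ->; rewrite msupp0.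
move=> /max_g/predU1P[fg|fg]; last by right; rewrite /monomial_lt fg.
rewrite fg in zf *; have [->|ba] := eqVneq b a; [by left|right].
by rewrite /monomial_lt /= eqxx ba max_a ?orbT.
Qed.

Theorem theorem3p4 (K : fieldType) (charK0 : [pchar K]%R =i pred0)
    (leU : rel Umon) (leU_adm : admissible_order leU) :
  is_Groebner_basis leU (fun z : freeKU K => z \in f_basis K) (@Ker_pi K).
Proof.
split=> [|z zf|z kz z0].
- split=> [|z1 z2 k1 k2|a z b kz]; first by rewrite /Ker_pi rmorph0.
    exact: Ker_piD.
  exact: Ker_piP.
- exact: f_basis_Ker.
have [[a g] lead_z] := leading_exists leU_adm z0.
have /hasP[m /(leading_wordsP charK0)[b bf bm] /infixP[h1 [h2 gE]]] : reducible g.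
  case: lead_z; rewrite /monomial_coeff /= => zg max_g.
  apply: (Ker_pi_leading_reducible charK0 kz) => [|f zf].
    by apply: contraNneq zg => ->; rewrite mcoeff0.
  (* A word with nonzero coefficient in K[U] carries some monomial of z, to which maximality
     applies. *)
  have [c zfc] : exists c, (monalg.mcoeff f z)@_c != 0.
    by exists (mlead (monalg.mcoeff f z)); rewrite mleadc_eq0.
  have [[_ ->]|] := max_g (c, f) zfc; first by left.
  by rewrite /monomial_lt /= word_ltE => /orP[|/andP[/eqP->]]; [right|left].
exists b, (0%MM, monalg.FMonom m), (a, g); split=> //; first exact: leads_is_leading.
(* The leading monomial of the generator has trivial part in [U], so the whole of [a] is the
   cofactor. *)
exists a, (monalg.FMonom h1), (monalg.FMonom h2); split; first by rewrite addm0.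
by apply: val_inj; rewrite /= !fmM /= -catA.
Qed.
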